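(* Let $1<p<\infty$ with $p\neq2$. For $t>1$, let $\xi_1=\xi_1(t)$ and $\xi_2=\xi_2(t)$ denote the two distinct positive solutions $x$ of the equation $$x^{p-1}(pt-x)=p-1,$$ with $\xi_1<\xi_2$. Then there is a unique value $\tau$ of $t$ (in $(1,\infty)$) for which $$(pt-\xi_1)|\xi_1-t|^{p-2}=(pt-\xi_2)|\xi_2-t|^{p-2},$$ and it satisfies $$\tau=\tau_p=\lim_{d\to\infty}T_{d,p}.$$ Moreover, for $t=\tau_p$ there is no $f(z)=\sum_{k\ge0}a_kz^k\in\ell^p_A$ with real coefficients and $f(0)\neq0$ satisfying, with $a_{-1}:=0$, the recurrence relations $$(p\,a_kt-a_{k+1})\,|a_{k+1}-ta_k|^{p-2}=(p-1)\,a_{k-1}\,|a_k-ta_{k-1}|^{p-2}\quad\text{for all } k\ge0.$$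
   Context: For $1<p<\infty$, $\ell^p_A$ is the Banach space of power series $f(z)=\sum_{k\ge 0}a_kz^k$ (complex coefficients) with $\|f\|_p=\left(\sum_{k\ge0}|a_k|^p\right)^{1/p}<\infty$. $\mathscr{P}_d$ is the space of complex polynomials of degree at most $d$. For nonzero $f\in\ell^p_A$, $t_f$ denotes the unique complex number with $\|(1-t_fz)f(z)\|_p=\min_{t\in\mathbb{C}}\|(1-tz)f(z)\|_p$. For $d\in\mathbb{N}=\{1,2,\dots\}$, $T_{d,p}:=\sup\{|t_f|: f\in\mathscr{P}_d,\ f\neq0\}$, and $\tau_p:=\sup_{d\in\mathbb{N}}T_{d,p}$. *)

(* Defs.v *)
From HB Require Import structures.
From mathcomp Require Import all_boot all_order all_algebra.
From mathcomp Require Import all_classical all_reals all_analysis.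
From mathcomp.real_closed Require Import complex.
Set Implicit Arguments.
Unset Strict Implicit.
Unset Printing Implicit Defensive.
Import Order.TTheory GRing.Theory Num.Theory.
Import numFieldNormedType.Exports.
Local Open Scope classical_set_scope.
Local Open Scope complex_scope.
Local Open Scope ring_scope.

(* A power series is represented by its sequence of coefficients. *)

(* [prev a k] is a_{k-1}, with a_{-1} := 0. *)
Definition prev (V : nmodType) (a : nat -> V) (k : nat) : V :=
  if k is j.+1 then a j else 0.

Section PowerSeries.
Variables (R : realType) (p : R).
Implicit Types (a : nat -> R[i]) (t : R[i]) (d : nat).

(* The R-valued modulus; MathComp's [`|z|] takes its values in R[i]. *)
Definition modulus (z : R[i]) : R := complex.Re `|z|.

Definition lpnorm a : \bar R :=
  poweR (\sum_(0 <= k <oo) (powR (modulus (a k)) p)%:E)%E p^-1.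

Definition in_lpA a : Prop := (lpnorm a < +oo)%E.

(* Coefficients of (1 - t z) f(z). *)
Definition mul_1mtz t a : nat -> R[i] := fun k => a k - t * prev a k.

(* t_f; the value 0 given by [xget] is used only where there is no minimizer. *)
Definition t_opt a : R[i] :=
  xget 0 [set t | forall s, (lpnorm (mul_1mtz t a) <= lpnorm (mul_1mtz s a))%E].

(* The suprema are taken in the extended reals, so that their finiteness is
   not presupposed. *)
Definition T_sup d : \bar R :=
  ereal_sup [set (modulus (t_opt (fun k => f`_k)))%:E
            | f in [set f : {poly R[i]} | (size f <= d.+1)%N /\ f != 0]].

Definition tau_sup : \bar R :=
  ereal_sup [set T_sup d | d in [set d | (1 <= d)%N]].

End PowerSeries.

Section RealEquations.
Variables (R : realType) (p : R).

Definition xi_equation (t x : R) : Prop := powR x (p - 1) * (p * t - x) = p - 1.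

Definition xi_pair (t x1 x2 : R) : Prop :=
  [/\ 0 < x1, x1 < x2 &
      forall x, 0 < x -> (xi_equation t x <-> x = x1 \/ x = x2)].

Definition xi_weight (t x : R) : R := (p * t - x) * powR `|x - t| (p - 2).

(* [powR 0 (p - 2)] is 0, since p <> 2. For p < 2 the power 0^(p-2) is
   undefined; with this value, sequences with a_{k+1} = t a_k for some k are
   also admitted, so a nonexistence claim covers them too. *)
Definition recurrence (t : R) (a : nat -> R) (k : nat) : Prop :=
  (p * a k * t - a k.+1) * powR `|a k.+1 - t * a k| (p - 2) =
  (p - 1) * prev a k * powR `|a k - t * prev a k| (p - 2).

End RealEquations.

(* Main.v *)
Require Import Defs.
From HB Require Import structures.
From mathcomp Require Import all_boot all_order all_algebra.
From mathcomp Require Import all_classical all_reals all_analysis.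
From mathcomp.real_closed Require Import complex.
From mathcomp Require Import ring lra.
Set Implicit Arguments.
Unset Strict Implicit.
Unset Printing Implicit Defensive.
Import Order.TTheory GRing.Theory Num.Theory.
Import numFieldNormedType.Exports.
Local Open Scope classical_set_scope.
Local Open Scope complex_scope.
Local Open Scope ring_scope.

(** Put w = y - t x and K_t(x, y) = Re(conj(x) w) |w|^(p-2). Up to the factor
    -p, the sum of the K_t(a_k, a_(k+1)) is the derivative in t of
    |(1 - t z) f|_p^p, so the sign of this sum decides on which side of t the
    minimizer t_f lies. With x = 1 the ratio q(y) = K_t(1, y) / (|y|^p - 1) has
    on y > 0 exactly the critical points xi_1 < 1 (minimum over (0, 1)) and
    xi_2 > t (maximum over (t, oo)), with values the two weights divided by p.
    The weight at xi_1 increases with t, the weight at xi_2 decreases, and tau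
    is where they meet.

    At tau, with c the common value of q, K_tau(x, y) <= c (|y|^p - |x|^p) for
    all complex x, y; the sum telescopes and is negative, hence |t_f| <= tau.
    For t < tau one has q(xi_1) < q(xi_2): a positive sequence with ratios xi_1
    and xi_2, chosen so as to stay bounded, makes the sum grow linearly, hence
    T_d >= t for large d.

    The recurrence is the Euler-Lagrange equation of the sum of the K_tau.
    Multiplied by a_k it says that (p-1) a_(k-1) a_k |a_k - tau a_(k-1)|^(p-2)
    grows by p K_tau(a_k, a_(k+1)) at each step. Telescoping bounds this
    quantity above by p c (|a_k|^p - |a_0|^p), while it is at least
    -(p-1) |a_k - tau a_(k-1)|^p; as a_k tends to 0, a_0 = 0. *)

(** * Convexity and monotonicity of real powers *)

Section PowerInequalities.
Variable R : realType.
Implicit Types a b l p q u v x y t : R.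

Lemma powR_convex q l a b : 1 <= q -> 0 <= l <= 1 -> 0 <= a -> 0 <= b ->
  (l * a + (1 - l) * b) `^ q <= l * a `^ q + (1 - l) * b `^ q.
Proof.
move=> q1 /andP[l0 l1] a0 b0.
have := @convex_powR R q q1 (Itv01 l0 l1) a b.
by rewrite !inE /= !in_itv /= !andbT => /(_ a0 b0).
Qed.

(** The convex inequality for the exponent 1/q, applied to the q-th powers of a and b. *)
Lemma powR_concave q l a b : 0 < q -> q <= 1 -> 0 <= l <= 1 -> 0 <= a -> 0 <= b ->
  l * a `^ q + (1 - l) * b `^ q <= (l * a + (1 - l) * b) `^ q.
Proof.
move=> q0 q1 l01 a0 b0; have /andP[l0 l1] := l01.
have qV1 : 1 <= q^-1 by rewrite invf_ge1.
have := powR_convex qV1 l01 (powR_ge0 a q) (powR_ge0 b q).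
rewrite -!powRrM mulfV ?gt_eqF// !powRr1// => h.
have s0 : 0 <= l * a `^ q + (1 - l) * b `^ q.
  by rewrite addr_ge0// mulr_ge0 ?powR_ge0// subr_ge0.
rewrite -[leLHS]powRr1// -[X in _ `^ X <= _](mulVf (lt0r_neq0 q0)) powRrM.
by apply: (ge0_ler_powR _ _ _ h); rewrite ?nnegrE ?powR_ge0 ?(ltW q0)// (le_trans _ h)
  ?powR_ge0.
Qed.

(** Young's inequality for v and u^(p-1), with exponents p and p/(p-1); no derivative is taken, so u
    = 0 is covered. *)
Lemma powR_subgradient p u v : 1 < p -> 0 <= u -> 0 <= v ->
  u `^ p + p * (u `^ (p - 1) * (v - u)) <= v `^ p.
Proof.
move=> p1 u0 v0; have p0 : 0 < p by lra.
have p10 : 0 < p - 1 by rewrite subr_gt0.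
have := @conjugate_powR R v (u `^ (p - 1)) p (p / (p - 1)) v0 (powR_ge0 _ _) p0.
rewrite divr_gt0// => /(_ isT); rewrite invf_div -powRrM.
rewrite (_ : (p - 1) * (p / (p - 1)) = p); last by field; rewrite gt_eqF.
have -> : p^-1 + (p - 1) / p = 1 by field; rewrite gt_eqF.
move=> /(_ erefl); rewrite -(ler_pM2l p0) -(mulr_powRB1 u0 p0).
set A := u `^ (p - 1); set B := v `^ p => h.
have -> : B = p * (B / p + u * A * ((p - 1) / p)) - u * A * (p - 1).
  by field; rewrite gt_eqF.
by apply: le_trans (lerB h (lexx _)); rewrite le_eqVlt; apply/orP; left; apply/eqP; ring.
Qed.

Lemma mulr_powRB2 p x : p != 1 -> 0 <= x -> x * x `^ (p - 2) = x `^ (p - 1).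
Proof.
move=> p1; rewrite le_eqVlt => /predU1P[<-|x0].
  by rewrite mul0r powR0// subr_eq0.
have -> : p - 2 = p - 1 - 1 by ring.
rewrite (@powRB _ x (p - 1) 1); last by rewrite (gt_eqF x0) implybT.
by rewrite powRr1 ?ltW// mulrC divfK// gt_eqF.
Qed.

Lemma powR_lt1 p y : 0 < p -> 0 <= y -> y < 1 -> y `^ p < 1.
Proof.
move=> p0 y0 y1; have := gt0_ltr_powR p0 _ _ y1.
by rewrite !nnegrE powR1; apply.
Qed.

Lemma powR_gt1 p y : 0 < p -> 1 < y -> 1 < y `^ p.
Proof.
move=> p0 y1; have := gt0_ltr_powR p0 _ _ y1.
by rewrite !nnegrE powR1; apply => //; rewrite ltW// (lt_trans _ y1).
Qed.

End PowerInequalities.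

(** * The two solutions of the xi-equation *)

Section Monotonicity.
Variable R : realType.

Lemma gt0_is_derive_lt (f df : R -> R) (a b : R) : a < b ->
  (forall x, x \in `[a, b]%R -> is_derive x 1 f (df x)) ->
  (forall x, x \in `]a, b[%R -> 0 < df x) -> f a < f b.
Proof.
move=> ab fdf df0; have oc x : x \in `]a, b[%R -> x \in `[a, b]%R.
  by rewrite !in_itv/= => /andP[/ltW -> /ltW ->].
have [c cab fE] : exists2 c, c \in `]a, b[%R & f b - f a = df c * (b - a).
  have fdf' x : x \in `]a, b[%R -> is_derive x 1 f (df x).
    by move=> /oc xab; apply: fdf.
  apply: (@MVT R f df a b ab fdf').
  apply: continuous_in_subspaceT => x.
  rewrite inE/= => xab.
  apply: differentiable_continuous.
  apply/derivable1_diffP.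
  by have [] := fdf _ xab.
by rewrite -subr_gt0 fE mulr_gt0 ?df0// subr_gt0.
Qed.

Lemma lt0_is_derive_gt (f df : R -> R) (a b : R) : a < b ->
  (forall x, x \in `[a, b]%R -> is_derive x 1 f (df x)) ->
  (forall x, x \in `]a, b[%R -> df x < 0) -> f b < f a.
Proof.
move=> ab fdf df0; rewrite -ltrN2.
apply: (@gt0_is_derive_lt (fun x => - f x) (fun x => - df x)) => // x xab.
  by have h := fdf _ xab; exact: is_deriveN.
by rewrite oppr_gt0 df0.
Qed.

End Monotonicity.

Section CriticalPoints.
Variables (R : realType) (p t : R).
Hypotheses (p1 : 1 < p) (t1 : 1 < t).
Implicit Types x y : R.

(** The left side of the xi-equation. For x > 0 its derivative has the sign of (p-1) t - x, so it
    rises up to (p-1) t and falls afterwards. *)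
Let psi x := x `^ (p - 1) * (p * t - x).

Let p0 : 0 < p. Proof. by move: p1; lra. Qed.
Let pm1 : 0 < p - 1. Proof. by move: p1; lra. Qed.

Let psi_derive x : 0 < x ->
  is_derive x 1 psi (p * x `^ (p - 2) * ((p - 1) * t - x)).
Proof.
move=> x0; have h := @is_derive1_powR R (p - 1) x x0.
rewrite /psi; apply: is_derive_eq.
rewrite /GRing.scale /=.
rewrite /GRing.scale /= (_ : x `^ (p - 1) = x * x `^ (p - 2)).
  by rewrite (_ : p - 1 - 1 = p - 2); [ring | ring].
by rewrite (_ : p - 2 = p - 1 - 1); [rewrite mulr_powRB1// ltW | ring].
Qed.

Let psi_cont x : 0 < x -> {for x, continuous psi}.
Proof.
move=> x0; apply: differentiable_continuous; apply/derivable1_diffP.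
by have [] := psi_derive x0.
Qed.

Let psi_incr x y : 0 < x -> x < y -> y <= (p - 1) * t -> psi x < psi y.
Proof.
move=> x0 xy ypt; apply: (gt0_is_derive_lt xy).
  by move=> z; rewrite in_itv/= => /andP[xz _]; apply: psi_derive; exact: lt_le_trans xz.
move=> z; rewrite in_itv/= => /andP[xz zy].
have z0 := lt_trans x0 xz.
by rewrite !mulr_gt0 ?powR_gt0// subr_gt0 (lt_le_trans zy).
Qed.

Let psi_decr x y : (p - 1) * t <= x -> x < y -> psi y < psi x.
Proof.
have pt0 : 0 < (p - 1) * t by rewrite mulr_gt0 ?subr_gt0 ?(lt_trans _ t1).
move=> ptx xy; have x0 : 0 < x by apply: lt_le_trans ptx.
apply: (lt0_is_derive_gt xy).
  by move=> z; rewrite in_itv/= => /andP[xz _]; apply: psi_derive; exact: lt_le_trans xz.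
move=> z; rewrite in_itv/= => /andP[xz zy].
rewrite pmulr_rlt0 ?subr_lt0 ?(le_lt_trans ptx)//.
by rewrite mulr_gt0 ?powR_gt0// (lt_trans x0).
Qed.

Let psi_root x y v : 0 < x -> x < y ->
  Num.min (psi x) (psi y) <= v <= Num.max (psi x) (psi y) ->
  exists2 z, z \in `[x, y]%R & psi z = v.
Proof.
move=> x0 xy; apply: IVT; first exact: ltW.
apply: continuous_in_subspaceT => z; rewrite inE/= in_itv/= => /andP[xz _].
by apply: psi_cont; exact: lt_le_trans xz.
Qed.

(** The function psi exceeds p - 1 at 1 and at t, is below it at some e < 1, and vanishes at p t.
    The intermediate value theorem gives a root in each of (e, 1) and (t, p t); unimodality of psi
    excludes a third. *)
Lemma xi_pair_ex : exists x1 x2, [/\ xi_pair p t x1 x2, x1 < 1 & t < x2].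
Proof.
have pow1 (a : R) : 1 `^ a = 1 by rewrite powR1.
have t0 : 0 < t by apply: lt_trans t1.
have pt0 : 0 < p * t by rewrite mulr_gt0.
have psi1 : p - 1 < psi 1 by rewrite /psi powR1 mul1r ltrD2r ltr_pMr.
have psit : p - 1 < psi t.
  rewrite /psi (_ : p * t - t = (p - 1) * t); last by ring.
  rewrite mulrCA ltr_pMr// mulrC (mulr_powRB1 (ltW t0) p0).
  by rewrite -[ltLHS](pow1 p) gt0_ltr_powR// nnegrE ltW.
have psipt : psi (p * t) = 0 by rewrite /psi subrr mulr0.
(* Chosen so that e^(p-1) = (p-1)/(p t); then psi e = (p-1)(p t - e)/(p t) < p - 1. *)
pose e := ((p - 1) / (p * t)) `^ (p - 1)^-1.
have q1 : (p - 1) / (p * t) < 1.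
  by rewrite ltr_pdivrMr// mul1r (lt_trans _ (_ : p < p * t)) ?ltr_pMr// gtrBl.
have q0 : 0 < (p - 1) / (p * t) by rewrite divr_gt0.
have e0 : 0 < e by exact: powR_gt0.
have e1 : e < 1.
  rewrite -[ltRHS](pow1 (p - 1)^-1) gt0_ltr_powR ?invr_gt0// nnegrE ?ler01//.
  exact: ltW.
have psie : psi e < p - 1.
  rewrite /psi -powRrM mulVf ?gt_eqF// powRr1 ?(ltW q0)//.
  rewrite mulrC mulrA ltr_pdivrMr// mulrC ltr_pM2l//.
  by rewrite gtrBl.
have [x1 + psix1] : exists2 z, z \in `[e, 1]%R & psi z = p - 1.
  by apply: psi_root => //; rewrite ge_min le_max (ltW psie) (ltW psi1) orbT.
rewrite in_itv/= => /andP[ex1 x11].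
have {}x11 : x1 < 1.
  by rewrite lt_neqAle x11 andbT; apply: contraL psi1 => /eqP h; rewrite
    -[X in psi X]h psix1 ltxx.
have [x2 + psix2] : exists2 z, z \in `[t, p * t]%R & psi z = p - 1.
  apply: psi_root => //; first by rewrite ltr_pMl.
  by rewrite psipt ge_min le_max (ltW psit) (ltW pm1) orbT.
rewrite in_itv/= => /andP[tx2 _].
have {}tx2 : t < x2.
  by rewrite lt_neqAle tx2 andbT; apply: contraL psit => /eqP h;
    rewrite [X in psi X]h psix2 ltxx.
have x12 : x1 < x2 by rewrite (lt_trans x11)// (lt_trans t1).
have x10 : 0 < x1 by exact: lt_le_trans ex1.
exists x1, x2; split => //; split => // x x0; split; last first.
  by case=> ->; rewrite /xi_equation -/(psi _).
rewrite /xi_equation -/(psi x) => psix.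
have x1pt : x1 < (p - 1) * t.
  by rewrite ltNge; apply/negP => h; have := psi_decr h x12; rewrite psix1 psix2 ltxx.
have x2pt : (p - 1) * t < x2.
  by rewrite ltNge; apply/negP => h; have := psi_incr x10 x12 h; rewrite psix1 psix2 ltxx.
have [xpt|ptx] := leP x ((p - 1) * t).
  left; case: (ltgtP x x1) => // h.
    by have := psi_incr x0 h (ltW x1pt); rewrite psix1 psix ltxx.
  by have := psi_incr x10 h xpt; rewrite psix1 psix ltxx.
right; case: (ltgtP x x2) => // h.
  by have := psi_decr (ltW ptx) h; rewrite psix2 psix ltxx.
by have := psi_decr (ltW x2pt) h; rewrite psix2 psix ltxx.
Qed.

Variables x1 x2 : R.
Hypothesis xi12 : xi_pair p t x1 x2.

Let x10 : 0 < x1. Proof. by case: xi12. Qed.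
Let x12 : x1 < x2. Proof. by case: xi12. Qed.
Let x20 : 0 < x2. Proof. exact: lt_trans x10 x12. Qed.
Let psix1 : psi x1 = p - 1.
Proof. by case: xi12 => _ _ /(_ _ x10)[_ h]; apply: h; left. Qed.
Let psix2 : psi x2 = p - 1.
Proof. by case: xi12 => _ _ /(_ _ x20)[_ h]; apply: h; right. Qed.

(** The roots from [xi_pair_ex] are among x1 and x2 and lie on the two sides of 1; the order x1 < x2
    leaves only one matching. *)
Lemma xi_pair_bounds : x1 < 1 /\ t < x2.
Proof.
have [r1 [r2 [[r10 r12 rE] r11 tr2]]] := xi_pair_ex.
have [_ _ xiE] := xi12; have r20 := lt_trans r10 r12.
have /xiE-/(_ r10) r1x : xi_equation p t r1 by apply/(rE _ r10); left.
have /xiE-/(_ r20) r2x : xi_equation p t r2 by apply/(rE _ r20); right.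
case: r1x r12 r11 => ->; case: r2x tr2 => -> //.
- by move=> _; rewrite ltxx.
- by move=> _ /(lt_trans x12); rewrite ltxx.
- by move=> _; rewrite ltxx.
Qed.

Let x11 : x1 < 1. Proof. by case: xi_pair_bounds. Qed.
Let tx2 : t < x2. Proof. by case: xi_pair_bounds. Qed.
Let x1pt : x1 < (p - 1) * t.
Proof. by rewrite ltNge; apply/negP => /psi_decr/(_ x12); rewrite psix1 psix2 ltxx. Qed.
Let x2pt : (p - 1) * t < x2.
Proof. by rewrite ltNge; apply/negP => /(psi_incr x10 x12); rewrite psix1 psix2 ltxx. Qed.

Let psi_ltl y : 0 < y -> y < x1 -> psi y < p - 1.
Proof. by move=> y0 yx1; rewrite -psix1 psi_incr// ltW. Qed.

Let psi_ltr y : x2 < y -> psi y < p - 1.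
Proof. by move=> x2y; rewrite -psix2 psi_decr// ltW. Qed.

Let psi_gt y : x1 < y -> y < x2 -> p - 1 < psi y.
Proof.
move=> x1y yx2; have [ypt|/ltW pty] := leP y ((p - 1) * t).
  by rewrite -psix1 psi_incr.
by rewrite -psix2 psi_decr.
Qed.

Let t0 : 0 < t. Proof. exact: lt_trans t1. Qed.

(** For a solution x the equation turns (p t - x)(x^p - 1) into p (x - t). Hence the weight over p
    is the value of q at x. *)
Lemma xi_weight_powR x : 0 < x -> xi_equation p t x ->
  xi_weight p t x * (x `^ p - 1) = p * ((x - t) * `|x - t| `^ (p - 2)).
Proof.
move=> x0 xE; rewrite /xi_weight.
have xp : x `^ p = x * x `^ (p - 1) by rewrite mulr_powRB1// ltW.
suff h : (p * t - x) * (x `^ p - 1) = p * (x - t) by rewrite mulrAC h; ring.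
have xp0 : x `^ (p - 1) != 0 by rewrite gt_eqF// powR_gt0.
apply: (mulfI xp0); rewrite mulrA xE xp.
move: xE; rewrite /xi_equation; move: (x `^ (p - 1)) => c xE.
rewrite (_ : (p - 1) * _ = p * x * c - x * c - (p - 1)); last by ring.
by rewrite -xE; ring.
Qed.

(* The logarithm of |t - y|^(p-1) / |1 - y^p|; the sign s is 1 on (0, 1) and -1
   on (t, oo). *)
Let lnF (s y : R) := (p - 1) * ln (s * (t - y)) - ln (s * (1 - y `^ p)).

Let dom (s y : R) := [&& 0 < y, 0 < s * (t - y) & 0 < s * (1 - y `^ p)].

Let dlnF (s y : R) :=
  s ^+ 2 * (psi y - (p - 1)) / (s * (t - y) * (s * (1 - y `^ p))).

Let lnF_derive s y : dom s y -> is_derive y 1 (lnF s) (dlnF s y).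
Proof.
case/and3P => y0 ty yp.
have h1 := is_derive1_ln ty; have h2 := is_derive1_ln yp.
have h3 := @is_derive1_powR R p y y0.
have d1 : is_derive y 1 (fun y => s * (t - y)) (- s).
  by apply: is_derive_eq; rewrite /GRing.scale/=; ring.
have d2 : is_derive y 1 (fun y => s * (1 - y `^ p)) (- s * (p * y `^ (p - 1))).
  by apply: is_derive_eq; rewrite /GRing.scale/=; ring.
have h4 : is_derive y 1 (fun y => ln (s * (t - y))) ((s * (t - y))^-1 * - s).
  exact: (@is_derive1_comp R (@ln R) (fun y => s * (t - y))).
have h5 : is_derive y 1 (fun y => ln (s * (1 - y `^ p)))
    ((s * (1 - y `^ p))^-1 * (- s * (p * y `^ (p - 1)))).
  exact: (@is_derive1_comp R (@ln R) (fun y => s * (1 - y `^ p))).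
rewrite /lnF; apply: is_derive_eq; rewrite /dlnF.
move: yp (gt_eqF yp) (gt_eqF ty).
rewrite /psi/GRing.scale/= -(mulr_powRB1 (ltW y0) p0).
move: (y `^ (p - 1)) => c yp yp0 ty0; field.
move/negbT: ty0; rewrite mulf_eq0 negb_or => /andP[-> ->].
by move/negbT: yp0; rewrite mulf_eq0 negb_or => /andP[_ ->].
Qed.

(** The denominator of [dlnF] is positive on [dom], so [lnF s] is monotone wherever psi stays on one
    side of p - 1, in the same direction for s = 1 and s = -1. *)
Let lnF_sgn s z : dom s z ->
  Num.sg (dlnF s z) = Num.sg (psi z - (p - 1)).
Proof.
case/and3P => z0 tz zp; have s0 : s != 0.
  by apply: contraTneq tz => ->; rewrite mul0r ltxx.
rewrite /dlnF mulrAC sgrM [X in X * _]gtr0_sg ?mul1r//.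
by rewrite divr_gt0 ?exprn_even_gt0// mulr_gt0.
Qed.

Let lnF_lt s x y : x < y -> (forall z, x <= z -> z <= y -> dom s z) ->
  (forall z, x < z -> z < y -> p - 1 < psi z) -> lnF s x < lnF s y.
Proof.
move=> xy ds ps; apply: (@gt0_is_derive_lt R (lnF s) (dlnF s) x y xy).
  by move=> z; rewrite in_itv/= => /andP[xz zy]; exact: lnF_derive (ds _ xz zy).
move=> z; rewrite in_itv/= => /andP[xz zy].
by rewrite -sgr_gt0 lnF_sgn ?ds 1?ltW// sgr_gt0 subr_gt0 ps.
Qed.

Let lnF_gt s x y : x < y -> (forall z, x <= z -> z <= y -> dom s z) ->
  (forall z, x < z -> z < y -> psi z < p - 1) -> lnF s y < lnF s x.
Proof.
move=> xy ds ps; apply: (@lt0_is_derive_gt R (lnF s) (dlnF s) x y xy).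
  by move=> z; rewrite in_itv/= => /andP[xz zy]; exact: lnF_derive (ds _ xz zy).
move=> z; rewrite in_itv/= => /andP[xz zy].
by rewrite -sgr_lt0 lnF_sgn ?ds 1?ltW// sgr_lt0 subr_lt0 ps.
Qed.

Let lnF_ratio s x y : dom s x -> dom s y -> lnF s x <= lnF s y ->
  (s * (t - x)) `^ (p - 1) * (s * (1 - y `^ p)) <=
  (s * (t - y)) `^ (p - 1) * (s * (1 - x `^ p)).
Proof.
case/and3P => x0 tx xp; case/and3P => y0 ty yp.
rewrite /lnF lerBlDr addrAC lerBrDr -!ln_powR.
by rewrite -!lnM ?posrE ?powR_gt0// ler_ln// posrE mulr_gt0// powR_gt0.
Qed.

Let dom1 y : 0 < y -> y < 1 -> dom 1 y.
Proof.
move=> y0 y1; rewrite /dom y0 !mul1r !subr_gt0 (lt_trans y1)//=.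
by rewrite powR_lt1// ltW.
Qed.

Let domN1 y : t < y -> dom (- 1) y.
Proof.
move=> ty; rewrite /dom !mulN1r !opprB !subr_gt0 ty (lt_trans _ ty)//=.
by rewrite powR_gt1// (lt_trans _ ty).
Qed.

(** On (0, 1), psi is below p - 1 before x1 and above it after, so [lnF 1] falls and then rises. *)
Let lnF_min y : 0 < y -> y < 1 -> lnF 1 x1 <= lnF 1 y.
Proof.
move=> y0 y1; case: (ltgtP x1 y) => [x1y|yx1|->//]; apply/ltW.
  apply: lnF_lt => // z xz zy.
    by apply: dom1; [exact: lt_le_trans xz | exact: le_lt_trans y1].
  by apply: psi_gt => //; rewrite (lt_trans zy)// (lt_trans y1)// (lt_trans _ tx2).
apply: lnF_gt => // z yz zx.
  by apply: dom1; [exact: lt_le_trans yz | exact: le_lt_trans x11].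
by apply: psi_ltl => //; exact: lt_trans yz.
Qed.

(** On (t, oo), psi is above p - 1 before x2 and below it after, so [lnF (- 1)] rises and then
    falls. *)
Let lnF_max y : t < y -> lnF (- 1) y <= lnF (- 1) x2.
Proof.
move=> ty; case: (ltgtP x2 y) => [x2y|yx2|->//]; apply/ltW.
  apply: lnF_gt => // z xz zy; first by apply: domN1; exact: lt_le_trans xz.
  exact: psi_ltr.
apply: lnF_lt => // z yz zx; first by apply: domN1; exact: lt_le_trans yz.
by apply: psi_gt => //; rewrite (lt_trans _ yz)// (lt_trans x11)// (lt_trans t1).
Qed.

Lemma xi_weight1 : xi_weight p t x1 * (1 - x1 `^ p) = p * (t - x1) `^ (p - 1).
Proof.
have tx : 0 < t - x1 by rewrite subr_gt0 (lt_trans x11).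
rewrite -(opprB _ 1) mulrN xi_weight_powR// -mulrN -mulNr opprB distrC.
by rewrite gtr0_norm// mulr_powRB2 ?(ltW tx)// gt_eqF.
Qed.

Lemma xi_weight2 : xi_weight p t x2 * (x2 `^ p - 1) = p * (x2 - t) `^ (p - 1).
Proof.
have tx : 0 < x2 - t by rewrite subr_gt0.
by rewrite xi_weight_powR// gtr0_norm// mulr_powRB2 ?(ltW tx)// gt_eqF.
Qed.

Lemma xi_weight1_gt0 : 0 < xi_weight p t x1.
Proof.
have x1p : 0 < 1 - x1 `^ p by rewrite subr_gt0 powR_lt1// ltW.
rewrite -(pmulr_lgt0 _ x1p) xi_weight1 mulr_gt0// powR_gt0// subr_gt0.
exact: lt_trans t1.
Qed.

Lemma xi_weight2_gt0 : 0 < xi_weight p t x2.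
Proof.
have x2p : 0 < x2 `^ p - 1 by rewrite subr_gt0 powR_gt1// (lt_trans _ tx2).
by rewrite -(pmulr_lgt0 _ x2p) xi_weight2 mulr_gt0// powR_gt0// subr_gt0.
Qed.

Lemma xi_weight1_le y : 0 <= y -> y < 1 ->
  xi_weight p t x1 * (1 - y `^ p) <= p * (t - y) `^ (p - 1).
Proof.
have x1p : 0 < 1 - x1 `^ p by rewrite subr_gt0 powR_lt1// ltW.
have pos z : 0 < z -> z < 1 ->
    xi_weight p t x1 * (1 - z `^ p) <= p * (t - z) `^ (p - 1).
  move=> z0 z1; have := lnF_ratio (dom1 x10 x11) (dom1 z0 z1) (lnF_min z0 z1).
  rewrite !mul1r -(ler_pM2l p0) !mulrA -xi_weight1 => h.
  by rewrite -(ler_pM2r x1p) mulrAC.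
rewrite le_eqVlt => /predU1P[<- _|]; last exact: pos.
rewrite powR0 ?gt_eqF// !subr0 mulr1 leNgt; apply/negP => lt_w.
have w0 := xi_weight1_gt0.
(* The case y = 0 is a limit. Here e is half the relative gap, so at the test point z with z^p = e
   the left side is the mean of the weight and p t^(p-1), still above p t^(p-1). *)
pose e := (1 - p * t `^ (p - 1) / xi_weight p t x1) / 2.
have e0 : 0 < e by rewrite divr_gt0// subr_gt0 ltr_pdivrMr// mul1r.
have e1 : e < 1.
  rewrite ltr_pdivrMr// mul1r (@lt_trans _ _ 1)//; last by rewrite ltr1n.
  by rewrite gtrBl divr_gt0// mulr_gt0// powR_gt0.
have pV0 : 0 < p^-1 by rewrite invr_gt0.
have z1 := powR_lt1 pV0 (ltW e0) e1; have z0 := powR_gt0 p^-1 e0.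
have := pos _ z0 z1; rewrite -powRrM mulVf ?gt_eqF// powRr1 ?(ltW e0)//.
have : p * (t - e `^ p^-1) `^ (p - 1) <= p * t `^ (p - 1).
  rewrite ler_pM2l// ge0_ler_powR ?nnegrE ?(ltW t0) ?(ltW pm1)//.
    by rewrite subr_ge0 ltW// (lt_trans z1).
  by rewrite lerBlDr lerDl ltW.
move=> h1 h2; have := le_trans h2 h1.
have -> : xi_weight p t x1 * (1 - e) = (xi_weight p t x1 + p * t `^ (p - 1)) / 2.
  by rewrite /e; field; rewrite gt_eqF.
move: lt_w; lra.
Qed.

Lemma xi_weight2_ge y : t <= y ->
  p * (y - t) `^ (p - 1) <= xi_weight p t x2 * (y `^ p - 1).
Proof.
rewrite le_eqVlt => /predU1P[<-|ty].
  rewrite subrr powR0 ?gt_eqF// mulr0 mulr_ge0 ?(ltW xi_weight2_gt0)//.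
  by rewrite subr_ge0 ltW// powR_gt1.
have x2p : 0 < x2 `^ p - 1 by rewrite subr_gt0 powR_gt1// (lt_trans _ tx2).
have := lnF_ratio (domN1 ty) (domN1 tx2) (lnF_max ty).
rewrite !mulN1r !opprB -(ler_pM2l p0) !mulrA -xi_weight2 => h.
by rewrite -(ler_pM2r x2p) [leRHS]mulrAC.
Qed.

End CriticalPoints.

(** * The crossing of the two weights *)

Section Crossing.
Variable R : realType.

(* If F is nondecreasing and F / K nonincreasing with K continuous, then F is
   continuous. *)
Lemma ratio_crossing (F K : R -> R) (a b : R) : a < b ->
  (forall s, a <= s -> s <= b -> 0 < F s) ->
  (forall s, a <= s -> s <= b -> 0 < K s) ->
  {within `[a, b], continuous K} ->
  (forall s t, a <= s -> s < t -> t <= b -> F s <= F t /\ F t * K s <= F s * K t) ->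
  F a <= 1 -> 1 <= F b -> exists2 c, c \in `[a, b]%R & F c = 1.
Proof.
move=> ab F0 K0 Kc FK Fa Fb; have ab' := ltW ab.
apply: IVT => //; last by rewrite ge_min le_max Fa Fb orbT.
have Ka : 0 < K a by exact: K0.
have Fb0 : 0 < F b by exact: F0.
(* From F t K s <= F s K t <= F t K t. *)
have KI s t : a <= s -> s < t -> t <= b -> K s <= K t.
  move=> as_ st tb; have [h1 h2] := FK _ _ as_ st tb.
  have Ft : 0 < F t by rewrite F0// (le_trans as_)// ltW.
  rewrite -(ler_pM2l Ft) (le_trans h2)// ler_wpM2r// ltW// K0//.
  by rewrite (le_trans as_)// ltW.
(* F is Lipschitz with respect to K: F t - F s <= (F s / K s)(K t - K s), and F s / K s <= F b / K
   a. *)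
have dF s t : a <= s -> s <= t -> t <= b ->
    `|F s - F t| <= F b / K a * `|K s - K t|.
  move=> as_; rewrite le_eqVlt => /predU1P[<-|st] tb.
    by rewrite !subrr !normr0 mulr0.
  have [h1 h2] := FK _ _ as_ st tb; have h3 := KI _ _ as_ st tb.
  have at_ : a <= t by rewrite (le_trans as_)// ltW.
  have sb : s <= b by rewrite (le_trans _ tb)// ltW.
  rewrite distrC (distrC (K s)) !ger0_norm ?subr_ge0//.
  have KaKs : K a <= K s.
    by move: as_; rewrite le_eqVlt => /predU1P[->//|as_]; exact: KI.
  have FsFb : F s <= F b.
    by move: sb; rewrite le_eqVlt => /predU1P[->//|sb]; have [] := FK _ _ as_ sb (lexx _).
  have Ks0 := K0 _ as_ sb.
  apply: (@le_trans _ _ (F s / K s * (K t - K s))).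
    rewrite -(ler_pM2r Ks0) mulrAC divfK ?gt_eqF// mulrBl mulrBr lerB//.
  rewrite ler_wpM2r ?subr_ge0//.
  by apply: ler_pM; rewrite ?invr_ge0 ?(ltW Ks0) ?(ltW (F0 _ _ _))// lef_pV2 ?posrE.
have {}dF s t : a <= s -> s <= b -> a <= t -> t <= b ->
    `|F s - F t| <= F b / K a * `|K s - K t|.
  move=> as_ sb at_ tb; case: (leP s t) => [st|/ltW ts]; first exact: dF.
  by rewrite distrC (distrC (K s)); exact: dF.
have C0 : 0 < F b / K a by rewrite divr_gt0.
apply/subspace_continuousP => s; rewrite /= in_itv/= => /andP[as_ sb].
have /subspace_continuousP/(_ s) := Kc.
rewrite /= in_itv/= as_ sb => /(_ isT) Ks.
apply/cvgrPdist_lt => e e0.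
have /cvgrPdist_lt/(_ (e / (F b / K a))) := Ks.
rewrite divr_gt0// => /(_ isT).
rewrite !near_withinE; apply: filterS => t h tab; have := h tab.
rewrite ltr_pdivlMr// mulrC; apply: le_lt_trans.
by move: tab; rewrite /= in_itv/= => /andP[? ?]; apply: dF.
Qed.

End Crossing.

(** * Monotonicity and growth of the two weights in t, and existence of tau *)

Section Tau.
Variables (R : realType) (p : R) (xi1 xi2 : R -> R).
Hypotheses (p1 : 1 < p) (p2 : p != 2).
Hypothesis xiP : forall t, 1 < t -> xi_pair p t (xi1 t) (xi2 t).
Implicit Types s t x y : R.

Let p0 : 0 < p. Proof. exact: lt_trans p1. Qed.
Let pm1 : 0 < p - 1. Proof. by rewrite subr_gt0. Qed.

Let alpha t := xi_weight p t (xi1 t).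
Let beta t := xi_weight p t (xi2 t).

Let xi1_gt0 t : 1 < t -> 0 < xi1 t. Proof. by case/xiP. Qed.
Let xi1_lt1 t : 1 < t -> xi1 t < 1.
Proof. by move=> t1; case: (xi_pair_bounds p1 t1 (xiP t1)). Qed.
Let xi2_gt t : 1 < t -> t < xi2 t.
Proof. by move=> t1; case: (xi_pair_bounds p1 t1 (xiP t1)). Qed.
Let xi1p t : 1 < t -> 0 < 1 - xi1 t `^ p.
Proof. by move=> t1; rewrite subr_gt0 powR_lt1// ?xi1_lt1// ltW// xi1_gt0. Qed.
Let xi2p t : 1 < t -> 0 < xi2 t `^ p - 1.
Proof. by move=> t1; rewrite subr_gt0 powR_gt1// (lt_trans t1)// xi2_gt. Qed.

Let alpha_gt0 t : 1 < t -> 0 < alpha t.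
Proof. by move=> t1; exact: xi_weight1_gt0 (xiP t1). Qed.
Let beta_gt0 t : 1 < t -> 0 < beta t.
Proof. by move=> t1; exact: xi_weight2_gt0 (xiP t1). Qed.
Let alpha_le t y : 1 < t -> 0 <= y -> y < 1 ->
  alpha t * (1 - y `^ p) <= p * (t - y) `^ (p - 1).
Proof. by move=> t1; exact: xi_weight1_le (xiP t1) y. Qed.
Let beta_ge t y : 1 < t -> t <= y ->
  p * (y - t) `^ (p - 1) <= beta t * (y `^ p - 1).
Proof. by move=> t1; exact: xi_weight2_ge (xiP t1) y. Qed.
Let alphaE t : 1 < t -> alpha t * (1 - xi1 t `^ p) = p * (t - xi1 t) `^ (p - 1).
Proof. by move=> t1; exact: xi_weight1 (xiP t1). Qed.
Let betaE t : 1 < t -> beta t * (xi2 t `^ p - 1) = p * (xi2 t - t) `^ (p - 1).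
Proof. by move=> t1; exact: xi_weight2 (xiP t1). Qed.

(** The extremal point [xi1 t] serves as a test point y at the parameter s, where p (s - y)^(p-1) is
    smaller than p (t - y)^(p-1). *)
Lemma xi_weight1_incr s t : 1 < s -> s < t ->
  xi_weight p s (xi1 s) < xi_weight p t (xi1 t).
Proof.
move=> s1 st; have t1 := lt_trans s1 st.
rewrite -(ltr_pM2r (xi1p t1)) [ltRHS]alphaE//.
have x0 := xi1_gt0 t1; have x1 := xi1_lt1 t1.
apply: (le_lt_trans (alpha_le s1 (ltW x0) x1)).
rewrite ltr_pM2l// gt0_ltr_powR ?nnegrE ?ltrD2r// subr_ge0 ltW//.
  exact: lt_trans s1.
exact: lt_trans t1.
Qed.

(** The extremal point [xi2 t] serves as a test point y at the parameter s, where p (y - s)^(p-1) is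
    larger than p (y - t)^(p-1). *)
Lemma xi_weight2_decr s t : 1 < s -> s < t ->
  xi_weight p t (xi2 t) < xi_weight p s (xi2 s).
Proof.
move=> s1 st; have t1 := lt_trans s1 st.
rewrite -(ltr_pM2r (xi2p t1)) [ltLHS]betaE//.
have x1 := xi2_gt t1; have sx := lt_trans st x1.
apply: (lt_le_trans _ (beta_ge s1 (ltW sx))).
by rewrite ltr_pM2l// gt0_ltr_powR ?nnegrE ?subr_ge0 ?ltrD2l ?ltrN2// ltW.
Qed.

(** Test y = [xi1 s] at t; then (t - y)/(s - y) <= (t - 1)/(s - 1), because y < 1. *)
Let alpha_growth s t : 1 < s -> s < t ->
  alpha t * (s - 1) `^ (p - 1) <= alpha s * (t - 1) `^ (p - 1).
Proof.
move=> s1 st; have t1 := lt_trans s1 st.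
have x0 := xi1_gt0 s1; have x1 := xi1_lt1 s1.
rewrite -(ler_pM2r (xi1p s1)) mulrAC [leRHS]mulrAC alphaE//.
apply: le_trans (ler_wpM2r (powR_ge0 _ _) (alpha_le t1 (ltW x0) x1)) _.
have sx : 0 <= s - xi1 s by rewrite subr_ge0 ltW// (lt_trans x1).
have tx : 0 <= t - xi1 s by rewrite subr_ge0 ltW// (lt_trans x1).
have s10 : 0 <= s - 1 by rewrite subr_ge0 ltW.
have t10 : 0 <= t - 1 by rewrite subr_ge0 ltW.
rewrite -!mulrA ler_pM2l// -!powRM//.
apply: ge0_ler_powR; rewrite ?nnegrE ?mulr_ge0 ?(ltW pm1)//.
rewrite -subr_ge0 (_ : _ - _ = (t - s) * (1 - xi1 s)); last by ring.
by rewrite mulr_ge0// subr_ge0 ltW.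
Qed.

(** Test at t the dilate z of [xi2 s] by t/s. It satisfies z - t = (t/s)(xi2 s - s), and the
    comparison of p-th powers comes down to (X - S)(T - S) >= 0. *)
Let beta_growth s t : 1 < s -> s < t ->
  beta s * (s `^ p - 1) <= beta t * (t `^ p - 1).
Proof.
move=> s1 st; have t1 := lt_trans s1 st.
have s0 : 0 < s by exact: lt_trans s1.
have t0 : 0 < t by exact: lt_trans t1.
have sx := xi2_gt s1; have x0 := lt_trans s0 sx.
pose z := xi2 s * (t / s).
have ts1 : 1 < t / s by rewrite ltr_pdivlMr// mul1r.
have tz : t < z by rewrite /z mulrCA ltr_pMr// ltr_pdivlMr// mul1r.
have zE : z `^ p = xi2 s `^ p * (t `^ p / s `^ p).
  by rewrite /z !powRM ?divr_ge0 ?invr_ge0 ?(ltW x0) ?(ltW s0) ?(ltW t0)// -!powRN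
    -powR_inv1 ?(ltW s0)// -powRrM mulN1r.
have S1 : 0 < s `^ p - 1 by rewrite subr_gt0 powR_gt1.
have h : beta s * (xi2 s `^ p - 1) <= beta t * (z `^ p - 1).
  rewrite betaE//; apply: le_trans (beta_ge t1 (ltW tz)).
  rewrite ler_pM2l// ge0_ler_powR ?nnegrE ?subr_ge0 ?(ltW p1) ?(ltW sx) ?(ltW tz)//.
  rewrite (_ : z - t = (t / s) * (xi2 s - s)); last by rewrite /z; field; rewrite gt_eqF.
  by rewrite ler_peMl ?subr_ge0 ?(ltW sx)// ltW.
rewrite -(ler_pM2r (xi2p s1)) mulrAC.
apply: le_trans (ler_wpM2r (ltW S1) h) _.
rewrite -[leLHS]mulrA -[leRHS]mulrA ler_pM2l ?beta_gt0// zE.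
have SX : s `^ p <= xi2 s `^ p.
  by rewrite ge0_ler_powR ?nnegrE ?(ltW s0) ?(ltW x0) ?(ltW sx) ?(ltW p0).
have ST : s `^ p <= t `^ p.
  by rewrite ge0_ler_powR ?nnegrE ?(ltW s0) ?(ltW t0) ?(ltW st) ?(ltW p0).
have : 0 < s `^ p by rewrite powR_gt0.
move: (s `^ p) (t `^ p) (xi2 s `^ p) SX ST => S T X SX ST S0.
rewrite -subr_ge0 (_ : _ - _ = (X - S) * (T - S) / S); last by field; rewrite gt_eqF.
by rewrite divr_ge0 ?(ltW S0)// mulr_ge0 ?subr_ge0.
Qed.

(** With t = 1 + e, the test point 1 - e gives alpha <= p 2^(p-1) e^(p-2), and the test point 3
    gives beta (3^p - 1) >= p. The choice e^(p-2) = 6^(-p) makes alpha 3^p <= p/2. *)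
Let near1_gt2 : 2 < p -> exists2 t, 1 < t < 2 & alpha t < beta t.
Proof.
move=> gt2; have pm2 : 0 < p - 2 by rewrite subr_gt0.
have d0 : 0 < (6 : R) `^ (- p) by rewrite powR_gt0.
have d1 : (6 : R) `^ (- p) < 1 by rewrite powRN invf_lt1 ?powR_gt0// powR_gt1// ltr1n.
pose e := ((6 : R) `^ (- p)) `^ (p - 2)^-1.
have e0 : 0 < e by exact: powR_gt0.
have e1 : e < 1 by rewrite powR_lt1 ?invr_gt0// ltW.
have eE : e `^ (p - 1) = e * 6 `^ (- p).
  by rewrite -(@mulr_powRB2 _ _ e) ?(gt_eqF p1) ?(ltW e0)// -powRrM mulVf
    ?gt_eqF// powRr1// ltW.
have t1 : 1 < 1 + e by rewrite ltrDl.
exists (1 + e); first by rewrite t1/= -[2]/(1 + 1) ltrD2l.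
have e1p : 0 < 1 - e by rewrite subr_gt0.
have := alpha_le t1 (ltW e1p); rewrite gtrBl e0 => /(_ isT).
rewrite (_ : 1 + e - (1 - e) = 2 * e); last by ring.
rewrite powRM ?(ltW e0)// eE => ha.
have he : (1 - e) `^ p <= 1 - e by rewrite ge1r_powR ?(ltW p1)// e1p gerBl ltW.
have t3 : 1 + e <= 3 by lra.
have := beta_ge t1 t3; set b3 := (3 : R) `^ p => hb.
have h3 : 1 <= (3 - (1 + e)) `^ (p - 1).
  rewrite -[leLHS](powRr0 (3 - (1 + e))) ler_powR ?(ltW pm1)//; lra.
have b30 : 0 < b3 by exact: powR_gt0.
have a0 := alpha_gt0 t1; have b0 := beta_gt0 t1.
have E6 : 2 `^ (p - 1) * 6 `^ (- p) * b3 = 2^-1 :> R.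
  rewrite (_ : 6 = 2 * 3)%R; last by rewrite -natrM.
  rewrite powRM// !powRN powRB ?pnatr_eq0 ?implybT// powRr1// -/b3.
  by field; rewrite !gt_eqF// powR_gt0.
have ha' : alpha (1 + e) <= p * (2 `^ (p - 1) * 6 `^ (- p)).
  rewrite -(ler_pM2r e0); apply: le_trans (_ : _ <= p * (2 `^ (p - 1) * (e * 6 `^ (- p)))) _.
    by apply: le_trans ha; rewrite ler_wpM2l ?(ltW a0)//; lra.
  by rewrite le_eqVlt; apply/orP; left; apply/eqP; ring.
rewrite -(ltr_pM2r b30); apply: le_lt_trans (ler_wpM2r (ltW b30) ha') _.
rewrite -mulrA E6; apply: (@lt_le_trans _ _ p).
  by rewrite ltr_pdivrMr// ltr_pMr// ltr1n.
have : p <= p * (3 - (1 + e)) `^ (p - 1) by rewrite ler_peMr// ltW.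
by move=> /le_trans/(_ hb)/le_trans; apply; rewrite ler_wpM2l ?(ltW b0)// gerBl.
Qed.

(** With t = 1 + e, the test point 0 gives alpha <= 2 p, and 1 + 2 e gives 8 beta >= p e^(p-2). The
    choice e^(2-p) = 1/32 makes beta >= 4 p. *)
Let near1_lt2 : p < 2 -> exists2 t, 1 < t < 2 & alpha t < beta t.
Proof.
move=> lt2; have pm2 : 0 < 2 - p by rewrite subr_gt0.
pose d : R := 32^-1.
have d0 : 0 < d by rewrite invr_gt0.
have d1 : d < 1 by rewrite invf_lt1// ltr1n.
pose e := d `^ (2 - p)^-1.
have e0 : 0 < e by exact: powR_gt0.
have e1 : e < 1 by rewrite powR_lt1 ?invr_gt0// ltW.
have eE : e `^ (p - 1) = e * 32.
  rewrite -(@mulr_powRB2 _ _ e) ?(gt_eqF p1) ?(ltW e0)// -(opprB 2) powRN -powRrM.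
  by rewrite mulVf ?gt_eqF// powRr1 ?(ltW d0)// invrK.
have t1 : 1 < 1 + e by rewrite ltrDl.
exists (1 + e); first by rewrite t1/= -[2]/(1 + 1) ltrD2l.
have := alpha_le t1 (lexx 0) ltr01; rewrite powR0 ?gt_eqF// !subr0 mulr1 => ha.
have he : (1 + e) `^ (p - 1) <= 1 + e by rewrite ler1_powR ?(ltW t1)//; lra.
have t3 : 1 + e <= 1 + 2 * e by lra.
have := beta_ge t1 t3; rewrite (_ : 1 + 2 * e - (1 + e) = e); last by ring.
rewrite eE => hb.
have h2 : (1 + 2 * e) `^ p <= (1 + 2 * e) ^+ 2.
  rewrite -powR_mulrn; last lra.
  by rewrite ler_powR ?(ltW lt2)//; lra.
have b0 := beta_gt0 t1.
have h8 : (1 + 2 * e) `^ p - 1 <= 8 * e by nra.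
have {}hb : p * 32 <= beta (1 + e) * 8.
  rewrite -(ler_pM2r e0); apply: le_trans (_ : _ <= beta (1 + e) * (8 * e)) _.
    apply: le_trans (ler_wpM2l (ltW b0) h8).
    by apply: le_trans hb; rewrite -mulrA (mulrC e).
  by rewrite mulrA.
have {}ha : alpha (1 + e) <= p * 2.
  by apply: le_trans ha _; rewrite ler_pM2l//; lra.
move: p0; lra.
Qed.

Let near1 : exists2 t, 1 < t < 2 & alpha t < beta t.
Proof.
case: (ltgtP p 2) => [|| /eqP]; [exact: near1_lt2 | exact: near1_gt2 |].
by rewrite (negbTE p2).
Qed.

(** The value p separates the two: (2 - xi1 2)^(p-1) > 1 gives alpha 2 > p, while y^(p-1) <= y^p - 1
    for y = xi2 2 gives beta 2 <= p. *)
Let at2 : beta 2 < alpha 2.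
Proof.
have lt12 : 1 < 2 :> R by rewrite ltr1n.
have a0 := alpha_gt0 lt12; have x0 := xi1_gt0 lt12; have x1 := xi1_lt1 lt12.
have y2 := xi2_gt lt12; have yp := xi2p lt12; have b0 := beta_gt0 lt12.
have y0 : 0 < xi2 2 by exact: lt_trans y2.
apply: (@le_lt_trans _ _ p).
  rewrite -(ler_pM2r yp) betaE// ler_pM2l//.
  have := ge0_ler_powR (ltW pm1) _ _ (_ : xi2 2 - 2 <= xi2 2).
  rewrite !nnegrE subr_ge0 (ltW y2) (ltW y0) gerBl ler0n => /(_ isT isT isT).
  move=> /le_trans; apply.
  rewrite -(mulr_powRB1 (ltW y0) p0).
  have : 1 < xi2 2 `^ (p - 1) by rewrite powR_gt1// (lt_trans lt12).
  move: (xi2 2 `^ (p - 1)) => c c1; nra.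
have : p * 1 < alpha 2 * (1 - xi1 2 `^ p).
  by rewrite alphaE// ltr_pM2l// powR_gt1//; lra.
rewrite mulr1 => /lt_le_trans; apply.
by rewrite ger_pMr// gerBl powR_ge0.
Qed.

Lemma tau_ex : exists2 tau, 1 < tau &
  xi_weight p tau (xi1 tau) = xi_weight p tau (xi2 tau).
Proof.
have [t0 /andP[t01 t02] t0ab] := near1.
pose F t := alpha t / beta t.
(* The product of the growth factors of the two weights: [alpha_growth] and [beta_growth] make F / K
   nonincreasing. *)
pose K t := (t - 1) `^ (p - 1) * (t `^ p - 1).
have Kd t : 1 < t -> {for t, continuous K}.
  move=> t1; have tm1 : 0 < t - 1 by rewrite subr_gt0.
  apply: differentiable_continuous; apply/derivable1_diffP.
  have h1 := is_derive1_powR p (lt_trans ltr01 t1).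
  have h2 := is_derive1_powR (p - 1) tm1.
  have h3 : is_derive t 1 (fun t => t - 1) 1.
    by apply: is_derive_eq; rewrite ?subr0 ?addr0.
  have h4 : is_derive t 1 (fun t => (t - 1) `^ (p - 1)) ((p - 1) * (t - 1) `^ (p - 1 - 1) * 1).
    exact: (@is_derive1_comp R (@powR R ^~ (p - 1)) (fun t => t - 1)).
  by apply: derivableM; apply: ex_derive.
have [] := @ratio_crossing R F K t0 2 t02.
- move=> s t0s _; have s1 := lt_le_trans t01 t0s.
  by rewrite divr_gt0 ?alpha_gt0 ?beta_gt0.
- move=> s t0s _; have s1 := lt_le_trans t01 t0s.
  by rewrite mulr_gt0 ?powR_gt0 ?subr_gt0 ?powR_gt1.
- apply: continuous_in_subspaceT => s; rewrite inE/= in_itv/= => /andP[t0s _].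
  exact/Kd/(lt_le_trans t01).
- move=> s t t0s st _; have s1 := lt_le_trans t01 t0s.
  have t1 := lt_trans s1 st; have bs := beta_gt0 s1; have bt := beta_gt0 t1.
  have h1 := xi_weight1_incr s1 st; have h2 := xi_weight2_decr s1 st; split.
    apply: ler_pM; rewrite ?invr_ge0 ?(ltW (alpha_gt0 _)) ?(ltW (beta_gt0 _)) ?(ltW h1)//.
    by rewrite lef_pV2 ?posrE ?(ltW h2).
  rewrite /F mulrAC [leRHS]mulrAC ler_pdivrMr// [leRHS]mulrAC ler_pdivlMr//.
  have a1 := alpha_growth s1 st; have b1 := beta_growth s1 st.
  rewrite /K (_ : _ * beta s = (alpha t * (s - 1) `^ (p - 1)) * (beta s * (s `^ p - 1)));
    last by ring.
  rewrite [leRHS](_ : _ = (alpha s * (t - 1) `^ (p - 1)) * (beta t * (t `^ p - 1)));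
    last by ring.
  apply: ler_pM => //; rewrite mulr_ge0 ?powR_ge0 ?(ltW (alpha_gt0 _)) ?(ltW bs)//.
  by rewrite subr_ge0 ltW// powR_gt1.
- by rewrite ler_pdivrMr ?beta_gt0// mul1r ltW.
- by rewrite ler_pdivlMr ?mul1r ?(ltW at2)// beta_gt0// ltr1n.
move=> c; rewrite in_itv/= => /andP[t0c _] Fc; have c1 := lt_le_trans t01 t0c.
exists c => //; rewrite -[RHS]mul1r -Fc divfK// gt_eqF//; exact: beta_gt0.
Qed.

End Tau.

(** * The kernel inequality *)

Section Kernel.
Variables (R : realType) (p t c : R).
Hypotheses (p1 : 1 < p) (t1 : 1 < t) (c0 : 0 <= c).
Hypothesis le_below : forall y, 0 <= y -> y < 1 ->
  c * (1 - y `^ p) <= (t - y) `^ (p - 1).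
Hypothesis ge_above : forall y, t <= y ->
  (y - t) `^ (p - 1) <= c * (y `^ p - 1).
Implicit Types d x y X Y Z : R.

Let p0 : 0 < p. Proof. exact: lt_trans p1. Qed.
Let pm1 : 0 < p - 1. Proof. by rewrite subr_gt0. Qed.
Let t0 : 0 < t. Proof. exact: lt_trans t1. Qed.

Let scale_powR X y : 0 < X -> 0 <= y -> X `^ p * (y / X) `^ p = y `^ p.
Proof.
move=> X0 y0; rewrite -powRM ?divr_ge0 ?(ltW X0)//.
by rewrite mulrC divfK ?gt_eqF.
Qed.

Let scale_powR1 X y : 0 < X -> 0 <= y ->
  X `^ p * (y / X) `^ (p - 1) = X * y `^ (p - 1).
Proof.
move=> X0 y0; rewrite -(mulr_powRB1 (ltW X0) p0) -mulrA -powRM ?divr_ge0 ?(ltW X0)//.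
by rewrite [X * (y / X)]mulrC divfK ?gt_eqF.
Qed.

(** The kernel inequality when x and y - t x point in the same direction; homogeneity reduces it to
    [ge_above] at |y|/|x|. *)
Let boundary_above X Z : 0 <= X -> 0 <= Z ->
  X * Z `^ (p - 1) <= c * ((t * X + Z) `^ p - X `^ p).
Proof.
rewrite le_eqVlt => /predU1P[<- Z0|X0 Z0].
  by rewrite mul0r mulr0 add0r powR0 ?gt_eqF// subr0 mulr_ge0// powR_ge0.
have Y0 : 0 <= t * X + Z by rewrite addr_ge0// mulr_ge0// ltW.
have : t <= (t * X + Z) / X by rewrite ler_pdivlMr// lerDl.
move=> /ge_above; rewrite -(ler_pM2l (powR_gt0 p X0)).
rewrite (_ : _ / X - t = Z / X); last by field; rewrite gt_eqF.
by rewrite scale_powR1// mulrCA mulrBr mulr1 scale_powR.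
Qed.

(** Covers x and y - t x in opposite directions. If Y >= X the signs decide; otherwise Z >= t X - Y
    and [le_below] applies to Y / X. *)
Let boundary_below X Y Z : 0 <= X -> 0 <= Y -> 0 <= Z -> t * X <= Y + Z ->
  - (X * Z `^ (p - 1)) <= c * (Y `^ p - X `^ p).
Proof.
move=> X0 Y0 Z0 tXYZ; case: (leP X Y) => [XY|YX].
  rewrite (@le_trans _ _ 0)//.
    by rewrite oppr_le0 mulr_ge0// powR_ge0.
  by rewrite mulr_ge0// subr_ge0 ge0_ler_powR ?nnegrE ?(ltW p0).
have {}X0 : 0 < X by exact: le_lt_trans YX.
have YX1 : Y / X < 1 by rewrite ltr_pdivrMr// mul1r.
rewrite lerNl -mulrN opprB.
have := le_below (divr_ge0 Y0 (ltW X0)) YX1.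
rewrite -(ler_pM2l (powR_gt0 p X0)) mulrCA mulrBr mulr1 scale_powR//.
move=> /le_trans; apply; rewrite -scale_powR1//.
rewrite ler_wpM2l ?powR_ge0// ge0_ler_powR ?nnegrE ?(ltW pm1) ?divr_ge0 ?(ltW X0)//.
  by rewrite subr_ge0 ltW// (lt_trans YX1).
by rewrite lerBlDr -mulrDl ler_pdivlMr// addrC.
Qed.

Let kernel_lt2 d X Y Z : p < 2 -> 0 < X -> 0 <= Y -> 0 < Z -> `|d| <= X * Z ->
  Y ^+ 2 = Z ^+ 2 + 2 * t * d + t ^+ 2 * X ^+ 2 ->
  d * Z `^ (p - 2) <= c * (Y `^ p - X `^ p).
Proof.
move=> lt2 X0 Y0 Z0; rewrite ler_norml => /andP[d1 d2] Y2.
have XZ0 : 0 < X * Z by rewrite mulr_gt0.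
(* The weight that writes d as a mean of X Z and -X Z. It also writes Y^2 as a mean of (t X + Z)^2
   and (t X - Z)^2, and u^(p/2) is concave. *)
pose l := (1 + d / (X * Z)) / 2.
have dE : d = l * (X * Z) - (1 - l) * (X * Z).
  by rewrite /l; field; rewrite !gt_eqF.
have l01 : 0 <= l <= 1.
  apply/andP; split.
    by rewrite divr_ge0// -lerBlDl sub0r ler_pdivlMr// mulN1r.
  by rewrite ler_pdivrMr// mul1r -[leRHS]/(1 + 1) lerD2l ler_pdivrMr// mul1r.
have [l0 l1] := andP l01.
have q0 : 0 < p / 2 by rewrite divr_gt0.
have q1 : p / 2 <= 1 by rewrite ler_pdivrMr// mul1r ltW.
have sq (z : R) : 0 <= z -> (z ^+ 2) `^ (p / 2) = z `^ p.
  by move=> z0; rewrite -powR_mulrn// -powRrM; congr (_ `^ _); field.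
have := powR_concave q0 q1 l01 (sqr_ge0 (t * X + Z)) (sqr_ge0 (t * X - Z)).
rewrite (_ : l * _ ^+ 2 + (1 - l) * _ ^+ 2 = Y ^+ 2); last first.
  by rewrite Y2 [in RHS]dE; ring.
have tXZ0 : 0 <= t * X + Z by rewrite addr_ge0 ?mulr_ge0// ltW.
rewrite -[(t * X - Z) ^+ 2]real_normK ?num_real// (sq _ tXZ0) (sq _ (normr_ge0 _)) (sq _ Y0).
move=> hY; have := boundary_above (ltW X0) (ltW Z0).
have tXZ : t * X <= `|t * X - Z| + Z by rewrite -lerBlDr ler_norm.
have := boundary_below (ltW X0) (normr_ge0 (t * X - Z)) (ltW Z0) tXZ.
have -> : d * Z `^ (p - 2) = l * (X * Z `^ (p - 1)) - (1 - l) * (X * Z `^ (p - 1)).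
  by rewrite {1}dE -(@mulr_powRB2 _ _ Z) ?(gt_eqF p1) ?(ltW Z0)//; ring.
move: (X * Z `^ (p - 1)) (`|_| `^ p) ((t * X + Z) `^ p) (X `^ p) (Y `^ p) hY.
move=> K B A Xp Yp hY hB hA.
have h1 : l * K <= l * (c * (A - Xp)) by rewrite ler_wpM2l.
have h2 : (1 - l) * - K <= (1 - l) * (c * (B - Xp)) by rewrite ler_wpM2l// subr_ge0.
have h3 : c * (l * A + (1 - l) * B) <= c * Yp by rewrite ler_wpM2l.
rewrite -mulrN; apply: le_trans (lerD h1 h2) _.
rewrite (_ : _ + _ = c * (l * A + (1 - l) * B) - c * Xp); last by ring.
by rewrite mulrBr lerB.
Qed.

Let kernel_ge2 d X Y Z : 2 <= p -> 0 <= X -> 0 < Y -> 0 < Z -> `|d| <= X * Z ->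
  Y ^+ 2 = Z ^+ 2 + 2 * t * d + t ^+ 2 * X ^+ 2 ->
  d * Z `^ (p - 2) <= c * (Y `^ p - X `^ p).
Proof.
move=> ge2 X0 Y0 Z0; rewrite ler_norml => /andP[d1 d2] Y2.
have tX0 : 0 <= t * X by rewrite mulr_ge0// ltW.
have YZ0 : 0 < 4 * (Y * Z) by rewrite !mulr_gt0.
(* For fixed Y and Z, X ranges from |Y - Z|/t to (Y + Z)/t, and l writes X^2 as a mean of the
   squares of these ends. As d is affine in X^2, it is the same mean of its end values. *)
pose l := ((t * X) ^+ 2 - (Y - Z) ^+ 2) / (4 * (Y * Z)).
pose X0' := (Y + Z) / t; pose X1' := `|Y - Z| / t.
have td1 : - (t * (X * Z)) <= t * d by rewrite -mulrN ler_pM2l.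
have td2 : t * d <= t * (X * Z) by rewrite ler_pM2l.
have Yle : Y <= Z + t * X.
  by rewrite -(@ler_pXn2r _ 2) ?nnegrE ?addr_ge0 ?(ltW Y0) ?(ltW Z0)// Y2; nra.
have leY : `|Z - t * X| <= Y.
  rewrite -(@ler_pXn2r _ 2) ?nnegrE ?(ltW Y0)// real_normK ?num_real// Y2; nra.
move: leY; rewrite ler_norml => /andP[leY1 leY2].
have l0 : 0 <= l by rewrite divr_ge0 ?(ltW YZ0)//; nra.
have l1 : l <= 1 by rewrite ler_pdivrMr// mul1r; nra.
have q1 : 1 <= p / 2 by rewrite ler_pdivlMr// mul1r.
have X0'0 : 0 <= X0' by rewrite divr_ge0 ?addr_ge0 ?ltW.
have X1'0 : 0 <= X1' by rewrite divr_ge0 ?normr_ge0 ?ltW.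
have sq (z : R) : 0 <= z -> (z ^+ 2) `^ (p / 2) = z `^ p.
  by move=> z0; rewrite -powR_mulrn// -powRrM; congr (_ `^ _); field.
have l01 : 0 <= l <= 1 by rewrite l0.
have := powR_convex q1 l01 (sqr_ge0 X0') (sqr_ge0 X1').
rewrite (_ : l * _ ^+ 2 + (1 - l) * _ ^+ 2 = X ^+ 2); last first.
  rewrite /X0' /X1' !exprMn real_normK ?num_real// /l; field.
  by rewrite !gt_eqF.
rewrite !sq// => hX.
have tX0' : t * X0' <= Y + Z by rewrite /X0' mulrC divfK ?gt_eqF.
have := boundary_below X0'0 (ltW Y0) (ltW Z0) tX0'.
have ZE : Z * Z `^ (p - 2) = Z `^ (p - 1).
  by rewrite mulr_powRB2 ?(gt_eqF p1) ?(ltW Z0).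
have : (Y - Z) / t * Z `^ (p - 1) <= c * (Y `^ p - X1' `^ p).
  rewrite /X1'; case: (leP Z Y) => ZY.
    rewrite ger0_norm ?subr_ge0//.
    have YZt : 0 <= (Y - Z) / t by rewrite divr_ge0 ?subr_ge0 ?(ltW t0).
    have := boundary_above YZt (ltW Z0).
    by rewrite [t * _]mulrC divfK ?gt_eqF// subrK.
  have YZt : 0 <= (Z - Y) / t by rewrite divr_ge0 ?subr_ge0 ?(ltW t0) ?(ltW ZY).
  rewrite distrC ger0_norm ?subr_ge0 ?(ltW ZY)// -(opprB Z Y) 2!mulNr.
  apply: boundary_below => //; rewrite ?ltW//.
  by rewrite mulrC divfK ?gt_eqF//; lra.
have -> : d * Z `^ (p - 2) =
    l * - (X0' * Z `^ (p - 1)) + (1 - l) * ((Y - Z) / t * Z `^ (p - 1)).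
  rewrite -ZE (_ : d = (Y ^+ 2 - Z ^+ 2 - (t * X) ^+ 2) / (2 * t)).
    by rewrite /l /X0'; field; rewrite !gt_eqF.
  by rewrite Y2; field; rewrite gt_eqF.
move: (X0' * _) (_ / t * _) (X0' `^ p) (X1' `^ p) (X `^ p) (Y `^ p) hX.
move=> K0 K1 A B Xp Yp hX h1 h0.
have {}h0 : l * - K0 <= l * (c * (Yp - A)) by rewrite ler_wpM2l.
have {}h1 : (1 - l) * K1 <= (1 - l) * (c * (Yp - B)) by rewrite ler_wpM2l// subr_ge0.
have h3 : c * Xp <= c * (l * A + (1 - l) * B) by rewrite ler_wpM2l.
apply: le_trans (lerD h0 h1) _.
rewrite (_ : _ + _ = c * Yp - c * (l * A + (1 - l) * B)); last by ring.
by rewrite mulrBr lerB.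
Qed.

(* [X], [Y], [Z] are the moduli of [x], [y] and [z = y - t x], and [d] is the
   real inner product of [x] and [z]. With [Z] fixed, the difference of the two
   sides is concave in [Y ^+ 2] if [p < 2] and concave in [X ^+ 2] if [p > 2];
   at the ends of the admissible range [x] and [y] are real-collinear. *)
Lemma kernel_modulus_le d X Y Z : 0 <= X -> 0 <= Y -> 0 <= Z -> `|d| <= X * Z ->
  Y ^+ 2 = Z ^+ 2 + 2 * t * d + t ^+ 2 * X ^+ 2 ->
  d * Z `^ (p - 2) <= c * (Y `^ p - X `^ p).
Proof.
move=> X0 Y0 Z0 dXZ Y2.
have d0_case : d = 0 -> X <= Y -> d * Z `^ (p - 2) <= c * (Y `^ p - X `^ p).
  move=> -> XY; rewrite mul0r mulr_ge0// subr_ge0.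
  by rewrite ge0_ler_powR ?nnegrE ?(ltW p0).
have [/eqP XZ0|XZ0] := eqVneq (X * Z) 0.
  have d0 : d = 0 by apply/eqP; rewrite -normr_le0 (le_trans dXZ)// (eqP XZ0).
  apply: d0_case => //; rewrite -(@ler_pXn2r _ 2)// Y2 d0 mulr0 addr0.
  by rewrite (@le_trans _ _ (t ^+ 2 * X ^+ 2)) ?lerDr ?sqr_ge0// ler_peMl
    ?sqr_ge0// exprn_ege1// ltW.
have {}X0 : 0 < X by rewrite lt_neqAle X0 andbT eq_sym; apply: contraNneq XZ0 => ->;
  rewrite mul0r.
have {}Z0 : 0 < Z by rewrite lt_neqAle Z0 andbT eq_sym; apply: contraNneq XZ0 => ->;
  rewrite mulr0.
case: (ltP p 2) => [lt2|ge2]; first exact: kernel_lt2.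
(* The weight in [kernel_ge2] divides by Y. For Y = 0 the constraint forces Z = t X and d = -X Z,
   which [boundary_below] covers. *)
move: Y0; rewrite le_eqVlt => /predU1P[Y0|Y0]; last exact: (kernel_ge2 _ (ltW X0)).
move: Y2; rewrite -Y0 expr0n/= => Y2; move: dXZ; rewrite ler_norml => /andP[d1 d2].
have td1 : - (t * (X * Z)) <= t * d by rewrite -mulrN ler_pM2l.
have ZtX : (Z - t * X) ^+ 2 = 0.
  by apply/eqP; rewrite eq_le sqr_ge0 andbT; nra.
have {}ZtX : t * X = Z by apply/eqP; rewrite eq_sym -subr_eq0 -sqrf_eq0; apply/eqP.
have dE : d = - (X * Z).
  apply: (mulfI (lt0r_neq0 t0)); move: Y2; rewrite -ZtX; nra.
rewrite dE mulNr -mulrA mulr_powRB2 ?(gt_eqF p1) ?(ltW Z0)//.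
by apply: boundary_below; rewrite ?(ltW X0) ?(ltW Z0)// add0r ZtX.
Qed.

Lemma real_kernel_le x y :
  x * (y - t * x) * `|y - t * x| `^ (p - 2) <= c * (`|y| `^ p - `|x| `^ p).
Proof.
apply: kernel_modulus_le => //; rewrite ?normrM// !real_normK ?num_real//.
by ring.
Qed.

End Kernel.

(** * Minimizers of finitely supported sequences *)

Section Modulus.
Variable R : realType.
Implicit Types (x y z s : R[i]) (r t p : R).

Definition inner x z : R :=
  complex.Re x * complex.Re z + complex.Im x * complex.Im z.

Lemma modulusE z :
  modulus z = Num.sqrt (complex.Re z ^+ 2 + complex.Im z ^+ 2).
Proof. by rewrite /modulus normc_def. Qed.

Lemma modulus_ge0 z : 0 <= modulus z.
Proof. by rewrite modulusE sqrtr_ge0. Qed.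

Lemma modulus_sqr z : modulus z ^+ 2 = complex.Re z ^+ 2 + complex.Im z ^+ 2.
Proof. by rewrite modulusE sqr_sqrtr// addr_ge0// sqr_ge0. Qed.

Lemma modulus_real r : modulus r%:C = `|r|.
Proof. by rewrite modulusE /= expr0n/= addr0 sqrtr_sqr. Qed.

Lemma modulus0 : modulus (0 : R[i]) = 0.
Proof. by rewrite (modulus_real 0) normr0. Qed.

Lemma modulus_eq0 z : modulus z = 0 -> z = 0.
Proof.
move=> z0; have := modulus_sqr z; rewrite z0 expr0n/= => /esym/eqP.
rewrite paddr_eq0 ?sqr_ge0// !sqrf_eq0 => /andP[/eqP a0 /eqP b0].
by case: z a0 b0 {z0} => a b /= -> ->.
Qed.

Lemma modulusM x y : modulus (x * y) = modulus x * modulus y.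
Proof.
apply/eqP; rewrite -(@eqrXn2 _ 2) ?mulr_ge0 ?modulus_ge0//.
rewrite exprMn !modulus_sqr; case: x => a b; case: y => c d /=.
by apply/eqP; ring.
Qed.

Lemma Re_le_modulus z : `|complex.Re z| <= modulus z.
Proof.
rewrite -(@ler_pXn2r _ 2) ?nnegrE ?normr_ge0 ?modulus_ge0//.
by rewrite real_normK ?num_real// modulus_sqr lerDl sqr_ge0.
Qed.

Lemma inner_le x z : `|inner x z| <= modulus x * modulus z.
Proof.
rewrite -(@ler_pXn2r _ 2) ?nnegrE ?normr_ge0 ?mulr_ge0 ?modulus_ge0//.
rewrite real_normK ?num_real// exprMn !modulus_sqr /inner.
case: x => a b; case: z => c d /=.
by have := sqr_ge0 (a * d - b * c); nra.
Qed.

Lemma modulus_shift_sqr r x z : modulus (z + r%:C * x) ^+ 2 =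
  modulus z ^+ 2 + 2 * r * inner x z + r ^+ 2 * modulus x ^+ 2.
Proof.
rewrite !modulus_sqr /inner; case: x => a b; case: z => c d /=.
by ring.
Qed.

Definition kernel p t x y : R :=
  inner x (y - t%:C * x) * modulus (y - t%:C * x) `^ (p - 2).

Lemma kernel0 p t y : kernel p t 0 y = 0.
Proof. by rewrite /kernel /inner /= !mul0r addr0 mul0r. Qed.

Lemma kernel_real p t (x y : R) :
  kernel p t x%:C y%:C = x * (y - t * x) * `|y - t * x| `^ (p - 2).
Proof.
by rewrite /kernel -rmorphM -rmorphB modulus_real /inner /= mul0r addr0.
Qed.

Lemma kernel_le p t (c : R) x y : 1 < p -> 1 < t -> 0 <= c ->
  (forall u : R, 0 <= u -> u < 1 -> c * (1 - u `^ p) <= (t - u) `^ (p - 1)) ->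
  (forall u : R, t <= u -> (u - t) `^ (p - 1) <= c * (u `^ p - 1)) ->
  kernel p t x y <= c * (modulus y `^ p - modulus x `^ p).
Proof.
move=> p1 t1 c0 hb ha; apply: (kernel_modulus_le p1 t1) => //.
- exact: modulus_ge0.
- exact: modulus_ge0.
- exact: modulus_ge0.
- exact: inner_le.
- by rewrite -modulus_shift_sqr subrK.
Qed.

(** The subgradient inequality for u^p at |z|, where Cauchy-Schwarz bounds |z||v| from below by the
    real inner product of z and v, which is |z|^2 - (r - t) [inner x z]. *)
Lemma modulus_powR_subgradient p t r x y : 1 < p ->
  modulus (y - t%:C * x) `^ p - p * (r - t) * kernel p t x y <=
  modulus (y - r%:C * x) `^ p.
Proof.
move=> p1; rewrite /kernel; set z := y - t%:C * x; set v := y - r%:C * x.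
have p0 : 0 < p by exact: lt_trans p1.
apply: le_trans (powR_subgradient p1 (modulus_ge0 z) (modulus_ge0 v)).
rewrite lerD2l -mulrA -mulrN ler_pM2l//.
rewrite -(@mulr_powRB2 _ _ (modulus z)) ?(gt_eqF p1) ?modulus_ge0//.
have zv : modulus z ^+ 2 - (r - t) * inner x z <= modulus z * modulus v.
  apply: le_trans (le_trans (ler_norm _) (inner_le z v)).
  rewrite modulus_sqr /inner /v.
  have -> : y - r%:C * x = z - (r - t)%:C * x by rewrite /z rmorphB; ring.
  case: x z {v} => a b [c d] /=.
  by rewrite le_eqVlt; apply/orP; left; apply/eqP; ring.
have := ler_wpM2r (powR_ge0 (modulus z) (p - 2)) zv.
move: (modulus z `^ (p - 2)) (modulus z) (modulus v) (inner x z) => w Z V d h.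
by lra.
Qed.

End Modulus.

(** * The sign of the kernel sum and the location of the minimizer *)

Section FiniteSupport.
Variables (R : realType) (p : R).
Hypothesis p1 : 1 < p.
Implicit Types (a : nat -> R[i]) (s : R[i]) (n : nat) (r t : R).

Let p0 : 0 < p. Proof. exact: lt_trans p1. Qed.

Lemma lpnorm_finite a n : (forall k, (n <= k)%N -> a k = 0) ->
  lpnorm p a = ((\sum_(k < n) modulus (a k) `^ p) `^ p^-1)%:E.
Proof.
move=> an; rewrite /lpnorm (nneseries_split 0 n) => [|k _]; last first.
  by rewrite lee_fin powR_ge0.
rewrite add0n eseries0 => [|k nk _]; last by rewrite an// modulus0 powR0// gt_eqF.
by rewrite adde0 sumEFin poweR_EFin big_mkord.
Qed.

(* [|(1 - s z) f|_p ^ p] without its constant term [|a_0| ^ p]. *)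
Definition shift_sum a n s : R :=
  \sum_(k < n) modulus (a k.+1 - s * a k) `^ p.

Lemma lpnorm_mul_1mtz a n s : (forall k, (n <= k)%N -> a k = 0) ->
  lpnorm p (mul_1mtz s a) = ((modulus (a 0%N) `^ p + shift_sum a n s) `^ p^-1)%:E.
Proof.
move=> an; rewrite (@lpnorm_finite _ n.+1) => [|[//|k] nk]; last first.
  by rewrite /mul_1mtz /= !an ?mulr0 ?subrr// ltnW.
by rewrite big_ord_recl /mul_1mtz /= mulr0 subr0.
Qed.

Lemma le_lpnorm_mul_1mtz a n s s' : (forall k, (n <= k)%N -> a k = 0) ->
  (lpnorm p (mul_1mtz s a) <= lpnorm p (mul_1mtz s' a))%E =
  (shift_sum a n s <= shift_sum a n s').
Proof.
move=> an; rewrite !(@lpnorm_mul_1mtz _ n)// lee_fin.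
have ge0 s1 : 0 <= modulus (a 0%N) `^ p + shift_sum a n s1.
  by rewrite addr_ge0 ?powR_ge0// sumr_ge0// => k _; rewrite powR_ge0.
have pV0 : 0 < p^-1 by rewrite invr_gt0.
rewrite -[RHS](lerD2l (modulus (a 0%N) `^ p)).
apply/idP/idP; last first.
  by move=> h; apply: (ge0_ler_powR _ _ _ h); rewrite ?nnegrE ?(ltW pV0).
by apply: contraTT; rewrite -!ltNge => h; apply: (gt0_ltr_powR _ _ _ h); rewrite ?nnegrE.
Qed.

(** Up to the factor -p, the derivative in t of [shift_sum a n (t%:C * w)]; w fixes a direction for
    the complex parameter, so that convexity is used along real lines only. *)
Definition kernel_sum t (w : R[i]) a n : R :=
  \sum_(k < n) kernel p t (w * a k) (a k.+1).

Lemma shift_sum_subgradient a n w t r :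
  shift_sum a n (t%:C * w) - p * (r - t) * kernel_sum t w a n
    <= shift_sum a n (r%:C * w).
Proof.
rewrite /kernel_sum mulr_sumr -sumrB; apply: ler_sum => k _.
by rewrite -!mulrA; have := modulus_powR_subgradient t r (w * a k) (a k.+1) p1; rewrite -!mulrA.
Qed.

Section UpperBound.
Variables (t c : R).
Hypotheses (t0 : 0 <= t) (c0 : 0 < c).
Hypothesis kernel_ub :
  forall x y : R[i], kernel p t x y <= c * (modulus y `^ p - modulus x `^ p).

Lemma kernel_sum_le w a n : modulus w = 1 ->
  kernel_sum t w a n <= c * (modulus (a n) `^ p - modulus (a 0%N) `^ p).
Proof.
move=> w1; elim: n => [|n IHn]; first by rewrite /kernel_sum big_ord0 subrr mulr0.
rewrite /kernel_sum big_ord_recr /= -/(kernel_sum t w a n).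
apply: le_trans (lerD IHn (kernel_ub _ _)) _.
by rewrite modulusM w1 mul1r; lra.
Qed.

(** The bound of [kernel_sum_le] is not strict when a_0 = 0, so the telescoping starts at the first
    nonzero coefficient instead. *)
Lemma kernel_sum_lt0 w a n : modulus w = 1 ->
  (forall k, (n <= k)%N -> a k = 0) -> (exists k, a k != 0) ->
  kernel_sum t w a n < 0.
Proof.
move=> w1 an; case/ex_minnP => j aj jmin.
have jn : (j < n)%N by rewrite ltnNge; apply: contra aj => /an ->.
have aj0 : 0 < c * modulus (a j) `^ p.
  rewrite mulr_gt0// powR_gt0// lt_neqAle modulus_ge0 andbT eq_sym.
  by apply: contra aj => /eqP/modulus_eq0 ->.
suff : kernel_sum t w a n <= c * modulus (a n) `^ p - c * modulus (a j) `^ p.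
  rewrite (an n)// modulus0 powR0 ?gt_eqF// mulr0 sub0r => /le_lt_trans; apply.
  by rewrite oppr_lt0.
have vanish k : (k < j)%N -> a k = 0.
  by move=> kj; apply/eqP; apply: contraLR kj => /jmin; rewrite -leqNgt.
have zero : kernel_sum t w a j = 0.
  by rewrite /kernel_sum big1// => k _; rewrite vanish// mulr0 kernel0.
have tail m : kernel_sum t w a (j + m) <=
    c * modulus (a (j + m)%N) `^ p - c * modulus (a j) `^ p.
  elim: m => [|m IHm]; first by rewrite addn0 zero subrr.
  rewrite addnS /kernel_sum big_ord_recr /= -/(kernel_sum t w a (j + m)).
  apply: le_trans (lerD IHm (kernel_ub _ _)) _.
  by rewrite modulusM w1 mul1r; lra.
by have := tail (n - j)%N; rewrite subnKC// ltnW.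
Qed.

(** If a minimizer s had modulus r > t, the negative kernel sum at t w, with w = s / r, would make
    the value at t w smaller than at s. The default 0 of [xget] satisfies the bound too. *)
Lemma t_opt_le a n : (forall k, (n <= k)%N -> a k = 0) ->
  (exists k, a k != 0) -> modulus (t_opt p a) <= t.
Proof.
move=> an a0; rewrite /t_opt; case: xgetP => [s _ smin|_]; last by rewrite modulus0.
rewrite leNgt; apply/negP => ts; set r := modulus s in ts.
have r0 : 0 < r by exact: le_lt_trans ts.
pose w := r^-1%:C * s.
have w1 : modulus w = 1.
  by rewrite modulusM modulus_real gtr0_norm ?invr_gt0// mulVf// gt_eqF.
have sE : s = r%:C * w.
  by rewrite /w mulrA -rmorphM mulfV ?gt_eqF// rmorph1 mul1r.
have := smin (t%:C * w); rewrite (le_lpnorm_mul_1mtz _ _ an) {1}sE.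
apply/negP; rewrite -ltNge; apply: lt_le_trans (shift_sum_subgradient _ _ _ t r).
rewrite ltrDl oppr_gt0 pmulr_rlt0 ?kernel_sum_lt0//.
by rewrite mulr_gt0// subr_gt0.
Qed.

End UpperBound.

Lemma continuous_norm_powR : continuous (fun r : R => `|r| `^ p).
Proof.
move=> u; have [->|u0] := eqVneq u 0.
  apply/cvgrPdist_lt => e e0; rewrite normr0 powR0 ?gt_eqF//.
  have d0 : 0 < e `^ p^-1 by exact: powR_gt0.
  apply: filterS (@nbhs0_lt R R^o _ d0) => v vd.
  rewrite sub0r normrN ger0_norm ?powR_ge0//.
  rewrite -[ltRHS]powRr1 ?(ltW e0)// -[X in _ < _ `^ X](mulVf (lt0r_neq0 p0)) powRrM.
  by rewrite gt0_ltr_powR ?nnegrE ?powR_ge0.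
apply: (@continuous_comp _ _ _ (fun r : R => `|r|) (fun r => r `^ p)).
  exact: norm_continuous.
apply: differentiable_continuous; apply/derivable1_diffP.
by apply: derivable_powR; rewrite in_itv/= andbT normr_gt0.
Qed.

Section RealCoefficients.
Variables (b : nat -> R) (n : nat).
Hypothesis bn : forall k, (n <= k)%N -> b k = 0.

Let a k : R[i] := (b k)%:C.

Let an k : (n <= k)%N -> a k = 0. Proof. by rewrite /a => /bn ->. Qed.

Let phi r : R := shift_sum a n r%:C.

Let phiE r : phi r = \sum_(k < n) `|b k.+1 - r * b k| `^ p.
Proof.
by apply: eq_bigr => k _; rewrite /a -rmorphM -rmorphB modulus_real.
Qed.

Let phi_continuous : continuous phi.
Proof.
rewrite (_ : phi = fun r => \sum_(k < n) `|b k.+1 - r * b k| `^ p); last exact/funext/phiE.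
elim: n => [|m IHm].
  by under eq_fun do rewrite big_ord0; move=> r; exact: cvg_cst.
under eq_fun do rewrite big_ord_recr /=.
move=> r; apply: cvgD; first exact: IHm.
apply: (@continuous_comp _ _ _ (fun r : R => b m.+1 - r * b m) (fun u => `|u| `^ p));
  last exact: continuous_norm_powR.
by apply: cvgB; [exact: cvg_cst | apply: cvgMl; exact: cvg_id].
Qed.

(** Since the coefficients are real, passing from s to its real part replaces each term by its real
    part. *)
Let phi_Re s : phi (complex.Re s) <= shift_sum a n s.
Proof.
rewrite phiE; apply: ler_sum => k _; apply: ge0_ler_powR.
- exact: ltW.
- by rewrite nnegrE.
- by rewrite nnegrE modulus_ge0.
apply: le_trans (Re_le_modulus _); rewrite le_eqVlt; apply/orP; left.
by case: s => u v /=; apply/eqP; congr `| _ |; ring.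
Qed.

Let phi_subgradient t r : phi t - p * (r - t) * kernel_sum t 1 a n <= phi r.
Proof. by have := shift_sum_subgradient a n 1 t r; rewrite !mulr1. Qed.

(** The signs of the kernel sums at t and tau make a minimum over [t, tau] global on the real line,
    hence on the complex plane by [phi_Re], so [t_opt] is a true minimizer. Left of t, phi exceeds
    phi t, so the real part of [t_opt] is at least t. *)
Lemma t_opt_ge t tau : t <= tau -> 0 < kernel_sum t 1 a n ->
  kernel_sum tau 1 a n <= 0 -> t <= modulus (t_opt p a).
Proof.
move=> ttau Kt Ktau.
have [r + rmin] := EVT_min ttau (continuous_subspaceT phi_continuous).
rewrite in_itv/= => /andP[tr rtau].
have phit u : u < t -> phi t < phi u.
  move=> ut; apply: lt_le_trans (phi_subgradient t u).
  by rewrite ltrDl oppr_gt0 -mulrA pmulr_rlt0// pmulr_llt0// subr_lt0.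
have min_r s : phi r <= shift_sum a n s.
  apply: le_trans (phi_Re s); set u := complex.Re s.
  case: (ltP u t) => [ut|tu].
    by apply: le_trans (ltW (phit _ ut)); rewrite rmin// in_itv/= lexx.
  case: (leP u tau) => [utau|tauu]; first by rewrite rmin// in_itv/= tu.
  apply: (@le_trans _ _ (phi tau)); first by rewrite rmin// in_itv/= lexx andbT.
  apply: le_trans (phi_subgradient tau u).
  by rewrite lerDl oppr_ge0 mulr_ge0_le0// mulr_ge0 ?subr_ge0 ?ltW.
have opt : forall s, (lpnorm p (mul_1mtz (t_opt p a) a) <= lpnorm p (mul_1mtz s a))%E.
  apply: (@xgetPex _ (0 : R[i]) [set u | forall s,
    (lpnorm p (mul_1mtz u a) <= lpnorm p (mul_1mtz s a))%E]).
  by exists r%:C => s; rewrite (le_lpnorm_mul_1mtz _ _ an).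
apply: le_trans (le_trans (ler_norm _) (Re_le_modulus _)).
rewrite leNgt; apply/negP => /phit; apply/negP; rewrite -leNgt.
apply: le_trans (phi_Re _) _.
by have := opt t%:C; rewrite (le_lpnorm_mul_1mtz _ _ an).
Qed.

End RealCoefficients.

End FiniteSupport.

(** * Bounds on T_d, and the recurrence *)

Section Zigzag.
Variables (R : realType) (p t c d y1 y2 : R).
Hypotheses (p1 : 1 < p) (t1 : 1 < t) (c0 : 0 <= c) (d0 : 0 < d).
Hypotheses (y10 : 0 < y1) (y11 : y1 < 1) (y21 : 1 < y2).
Hypothesis gain1 : c * (y1 `^ p - 1) + d <= (y1 - t) * `|y1 - t| `^ (p - 2).
Hypothesis gain2 : c * (y2 `^ p - 1) + d <= (y2 - t) * `|y2 - t| `^ (p - 2).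

Let p0 : 0 < p. Proof. exact: lt_trans p1. Qed.

(** The ratios y1 and y2 are switched at the level 1, which keeps the sequence in [y1, y2]; its
    lower bound y1 then makes the gain of each step at least d y1^p. *)
Let zigzag k : R := iter k (fun x => x * (if 1 <= x then y1 else y2)) 1.

Let zigzagP k : y1 <= zigzag k <= y2.
Proof.
elim: k => [|k /andP[h1 h2]] /=; first by rewrite !ltW.
have z0 : 0 < zigzag k by exact: lt_le_trans h1.
rewrite -/(zigzag k); case: (leP 1 (zigzag k)) => h; apply/andP; split.
- by rewrite ler_peMl// ltW.
- by rewrite (le_trans _ h2)// ger_pMr// ltW.
- by rewrite (le_trans h1)// ler_peMr ?(ltW z0)// ltW.
- by rewrite ger_pMl ?(ltW h)// (lt_trans ltr01).
Qed.

Let zigzag_gt0 k : 0 < zigzag k.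
Proof. by apply: lt_le_trans y10 _; case/andP: (zigzagP k). Qed.

Let kernel_scale x y : 0 < x ->
  kernel p t x%:C (x * y)%:C = x `^ p * ((y - t) * `|y - t| `^ (p - 2)).
Proof.
move=> x0; rewrite kernel_real (_ : x * y - t * x = x * (y - t)); last by ring.
rewrite normrM powRM// (gtr0_norm x0) -(mulr_powRB1 (ltW x0) p0).
by rewrite -(@mulr_powRB2 _ _ x) ?(gt_eqF p1) ?(ltW x0)//; ring.
Qed.

Let zigzag_step k :
  c * (zigzag k.+1 `^ p - zigzag k `^ p) + d * y1 `^ p <=
  kernel p t (zigzag k)%:C (zigzag k.+1)%:C.
Proof.
have x0 := zigzag_gt0 k; rewrite /= -/(zigzag k).
set y := if _ then _ else _; rewrite kernel_scale//.
have y0 : 0 < y by rewrite /y; case: ifP => // _; exact: lt_trans y21.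
have gain : c * (y `^ p - 1) + d <= (y - t) * `|y - t| `^ (p - 2).
  by rewrite /y; case: ifP.
apply: le_trans (ler_wpM2l (powR_ge0 _ _) gain).
have : d * y1 `^ p <= d * zigzag k `^ p.
  rewrite ler_pM2l//; apply: ge0_ler_powR; rewrite ?nnegrE ?(ltW p0) ?(ltW y10) ?(ltW x0)//.
  by case/andP: (zigzagP k).
rewrite powRM ?(ltW x0) ?(ltW y0)//.
move: (_ `^ p) (_ `^ p) (_ `^ p) => u v w; lra.
Qed.

Lemma zigzag_ex : exists (b : nat -> R) (n : nat), [/\ b 0%N = 1,
  forall k, (n < k)%N -> b k = 0 & 0 < kernel_sum p t 1 (fun k => (b k)%:C) n.+1].
Proof.
(* What n steps of gain must outweigh: c from the initial term of the telescoped sum, and y2 (t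
   y2)^(p-1) from cutting the sequence off after index n. *)
pose L := c + y2 * (t * y2) `^ (p - 1).
have y20 : 0 < y2 by exact: lt_trans y21.
have t0 : 0 < t by exact: lt_trans t1.
have L0 : 0 <= L by rewrite addr_ge0// mulr_ge0 ?powR_ge0// ltW.
have g0 : 0 < d * y1 `^ p by rewrite mulr_gt0// powR_gt0.
pose n := Num.bound (L / (d * y1 `^ p)).
have nL : L < d * y1 `^ p * n%:R.
  by rewrite -ltr_pdivrMl// mulrC archi_boundP// divr_ge0// ltW.
pose b k := if (k <= n)%N then zigzag k else 0.
exists b, n; split => [//|k nk|]; first by rewrite /b leqNgt nk.
(* The last of the n + 1 terms is the jump from b_n to 0; the others do not see the truncation. *)
rewrite /kernel_sum big_ord_recr /= !mul1r.
have -> : \sum_(i < n) kernel p t (1 * (b i)%:C) (b i.+1)%:C =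
    \sum_(i < n) kernel p t (zigzag i)%:C (zigzag i.+1)%:C.
  by apply: eq_bigr => i _; rewrite mul1r /b ltn_ord (ltnW (ltn_ord i)).
have sum m : c * (zigzag m `^ p - 1) + d * y1 `^ p * m%:R <=
    \sum_(i < m) kernel p t (zigzag i)%:C (zigzag i.+1)%:C.
  elim: m => [|m IHm]; first by rewrite big_ord0 /= powR1 subrr !mulr0 addr0.
  rewrite big_ord_recr /=; apply: le_trans (lerD IHm (zigzag_step m)).
  by rewrite -natr1 /=; lra.
have last_ge : - (y2 * (t * y2) `^ (p - 1)) <= kernel p t (b n)%:C (b n.+1)%:C.
  rewrite /b leqnn ltnn kernel_real; have x0 := zigzag_gt0 n.
  have [_ xy2] := andP (zigzagP n); have tx0 : 0 < t * zigzag n by rewrite mulr_gt0.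
  rewrite sub0r normrN (gtr0_norm tx0) mulrN mulNr lerN2 -mulrA.
  rewrite mulr_powRB2 ?(gt_eqF p1) ?(ltW tx0)//.
  apply: ler_pM => //; rewrite ?powR_ge0 ?(ltW x0)//.
  apply: ge0_ler_powR; rewrite ?nnegrE ?subr_ge0 ?(ltW p1) ?(ltW tx0)//.
    by rewrite mulr_ge0// ltW.
  by rewrite ler_pM2l.
apply: lt_le_trans (lerD (sum n) last_ge).
have : 0 <= c * zigzag n `^ p by rewrite mulr_ge0// powR_ge0.
by move: nL; rewrite /L; lra.
Qed.

End Zigzag.

(** * From bounds on single minimizers to the suprema and their limit *)

Section Suprema.
Variables (R : realType) (p : R).
Hypothesis p1 : 1 < p.

Let coef_finite (f : {poly R[i]}) k : (size f <= k)%N -> f`_k = 0.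
Proof. exact: nth_default. Qed.

Lemma T_sup_le t c d : 0 <= t -> 0 < c ->
  (forall x y : R[i], kernel p t x y <= c * (modulus y `^ p - modulus x `^ p)) ->
  (T_sup p d <= t%:E)%E.
Proof.
move=> t0 c0 kub; apply: ge_ereal_sup => _ [f [_ f0] <-]; rewrite lee_fin.
apply: (t_opt_le p1 t0 c0 kub (@coef_finite f)).
by exists (size f).-1; rewrite -lead_coefE lead_coef_eq0.
Qed.

Lemma T_sup_nondecreasing : nondecreasing_seq (T_sup p).
Proof.
move=> m n mn; apply: ereal_sup_le => _ [f [fm f0] <-].
by exists f => //; split => //; exact: leq_trans fm _.
Qed.

Lemma T_sup_ge (b : nat -> R) n t tau : t <= tau -> b 0%N = 1 ->
  (forall k, (n < k)%N -> b k = 0) ->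
  0 < kernel_sum p t 1 (fun k => (b k)%:C) n.+1 ->
  kernel_sum p tau 1 (fun k => (b k)%:C) n.+1 <= 0 ->
  (t%:E <= T_sup p n)%E.
Proof.
move=> ttau b0 bn Kt Ktau; pose f : {poly R[i]} := \poly_(k < n.+1) (b k)%:C.
have fE : (fun k => f`_k) = (fun k => (b k)%:C).
  by apply/funext => k; rewrite coef_poly; case: ltnP => // /bn ->.
apply: le_ereal_sup_tmp; exists (modulus (t_opt p (fun k => f`_k)))%:E.
  exists f => //; split; first exact: size_poly.
  by apply/eqP => /(congr1 (fun g : {poly R[i]} => g`_0));
    rewrite coef_poly/= b0 coef0 => /eqP; rewrite oner_eq0.
by rewrite lee_fin fE; apply: (t_opt_ge p1 _ ttau Kt Ktau).
Qed.

Lemma T_sup_cvg : T_sup p d @[d --> \oo] --> tau_sup p.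
Proof.
(* The index d = 0 is missing from [tau_sup]; as T_d is nondecreasing, including it does not change
   the supremum. *)
have -> : tau_sup p = ereal_sup (range (T_sup p)).
  apply/eqP; rewrite eq_le; apply/andP; split.
    by apply: ereal_sup_le => _ [d _ <-]; exists d.
  apply: ge_ereal_sup => _ [d _ <-]; apply: le_ereal_sup_tmp.
  by exists (T_sup p d.+1); [exists d.+1 | exact: T_sup_nondecreasing].
exact: ereal_nondecreasing_cvgn T_sup_nondecreasing.
Qed.

End Suprema.

(** * Vanishing of the initial term for summable solutions of the recurrence *)

Section Recurrence.
Variables (R : realType) (p t c : R) (a : nat -> R).
Hypotheses (p1 : 1 < p) (t1 : 1 < t) (c0 : 0 < c).
Hypothesis kernel_ub : forall x y : R,
  x * (y - t * x) * `|y - t * x| `^ (p - 2) <= c * (`|y| `^ p - `|x| `^ p).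
Hypothesis a_lp : in_lpA p (fun k => (a k)%:C).
Hypothesis a_rec : forall k, recurrence p t a k.

Let p0 : 0 < p. Proof. exact: lt_trans p1. Qed.

Let momentum k := (p - 1) * (Defs.prev a k * a k) * `|a k - t * Defs.prev a k| `^ (p - 2).

(* The recurrence times a_k, by Euler's identity for the homogeneous kernel. *)
Let momentumS k : momentum k.+1 = momentum k +
  p * (a k * (a k.+1 - t * a k) * `|a k.+1 - t * a k| `^ (p - 2)).
Proof.
have := a_rec k; rewrite /recurrence /momentum /=.
move: (`|a k.+1 - _| `^ _) (`|a k - _| `^ _) => v w /(congr1 ( *%R (a k))) h.
rewrite (_ : _ * w = a k * ((p - 1) * Defs.prev a k * w)); last by ring.
by rewrite -h; ring.
Qed.

(** At k = 0 both sides vanish because a_{-1} = 0; each step adds p times the kernel inequality. *)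
Let momentum_le k : momentum k <= p * c * (`|a k| `^ p - `|a 0%N| `^ p).
Proof.
elim: k => [|k IHk]; first by rewrite /momentum /= mul0r mulr0 mul0r subrr mulr0.
rewrite momentumS; have := ler_wpM2l (ltW p0) (kernel_ub (a k) (a k.+1)).
move: IHk; lra.
Qed.

Let momentum_ge k : - ((p - 1) * `|a k.+1 - t * a k| `^ p) <= momentum k.+1.
Proof.
rewrite /momentum /=; set z := a k.+1 - t * a k.
(* Only a negative product needs an argument: then every term of the expanded z^2 is nonnegative,
   and -2 t a_k a_{k+1} >= -a_k a_{k+1}. *)
have aa : - `|z| ^+ 2 <= a k * a k.+1.
  rewrite real_normK ?num_real// lerNl /z.
  have [aa|aa] := leP 0 (a k * a k.+1); first by rewrite (@le_trans _ _ 0) ?sqr_ge0// oppr_le0.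
  have : t * (a k * a k.+1) <= 1 * (a k * a k.+1) by rewrite ler_nM2r// ltW.
  by have := sqr_ge0 (a k.+1); have := sqr_ge0 (t * a k); lra.
rewrite -mulrN -mulrA ler_pM2l ?subr_gt0//.
apply: le_trans (ler_wpM2r (powR_ge0 _ _) aa).
by rewrite mulNr expr2 -mulrA mulr_powRB2 ?(gt_eqF p1)// mulr_powRB1.
Qed.

Let a_cvg0 : (fun k => `|a k| `^ p) @ \oo --> (0 : R).
Proof.
apply: cvg_series_cvg_0; apply: nnseries_is_cvg => [k|]; first exact: powR_ge0.
have := lty_poweRy _ a_lp; rewrite invr_eq0 gt_eqF// => /(_ isT).
by under eq_eseriesr do rewrite modulus_real.
Qed.

Lemma recurrence_lp_eq0 : a 0%N = 0.
Proof.
apply/eqP; apply/negPn/negP => a0.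
have m0 : 0 < `|a 0%N| `^ p by rewrite powR_gt0// normr_gt0.
pose C := p * c + (p - 1) * (1 + t) `^ p.
have C0 : 0 < C.
  by rewrite addr_gt0 ?mulr_gt0 ?subr_gt0 ?powR_gt0// addr_gt0// (lt_trans _ t1).
(* Chosen so that C e = p c |a_0|^p: once |a_k|^p < e for k = N and k = N + 1, the upper and lower
   bounds on the momentum contradict each other. *)
pose e := p * c * `|a 0%N| `^ p / C.
have e0 : 0 < e by rewrite divr_gt0// !mulr_gt0.
have /cvgrPdist_lt/(_ _ e0) [N _ hN] := a_cvg0.
have small k : (N <= k)%N -> `|a k| `^ p < e.
  by move=> /hN; rewrite /= sub0r normrN ger0_norm// powR_ge0.
have e1 k : (N <= k)%N -> `|a k| <= e `^ p^-1.
  move=> /small h; rewrite -[leLHS]powRr1// -(mulfV (lt0r_neq0 p0)) powRrM.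
  by apply: ge0_ler_powR; rewrite ?nnegrE ?powR_ge0 ?invr_ge0 ?(ltW p0) ?(ltW e0) ?(ltW h).
have h1 := momentum_le N.+1; have h2 := momentum_ge N.
have h3 := small _ (leqnSn N).
have t0 : 0 < t by exact: lt_trans t1.
have h4 : `|a N.+1 - t * a N| `^ p <= (1 + t) `^ p * e.
  have eE : e = (e `^ p^-1) `^ p by rewrite -powRrM mulVf ?gt_eqF// powRr1 ?ltW.
  rewrite [leRHS](_ : _ = ((1 + t) * e `^ p^-1) `^ p); last first.
    by rewrite powRM ?powR_ge0 ?addr_ge0 ?(ltW t0)// -eE.
  apply: ge0_ler_powR; rewrite ?nnegrE ?(ltW p0)//.
    by rewrite mulr_ge0 ?powR_ge0// addr_ge0// ltW.
  apply: le_trans (ler_normB _ _) _; rewrite normrM (gtr0_norm t0) mulrDl mul1r.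
  by apply: lerD; [exact: e1 | rewrite ler_wpM2l ?(ltW t0)// e1].
have eC : p * c * `|a 0%N| `^ p = p * c * e + (p - 1) * ((1 + t) `^ p * e).
  rewrite [RHS](_ : _ = C * e); last by rewrite /C; ring.
  by rewrite /e [RHS]mulrC divfK// gt_eqF.
have pc0 : 0 < p * c by rewrite mulr_gt0.
have h5 : (p - 1) * `|a N.+1 - t * a N| `^ p <= (p - 1) * ((1 + t) `^ p * e).
  by rewrite ler_wpM2l// subr_ge0 ltW.
have h6 : p * c * `|a N.+1| `^ p < p * c * e by rewrite ltr_pM2l.
move: (le_trans h2 h1); rewrite mulrBr eC; lra.
Qed.

End Recurrence.

Theorem theorem8p6 (R : realType) (p : R) (hp1 : 1 < p) (hp2 : p != 2) :
  exists xi1 xi2 : R -> R,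
    (forall t : R, 1 < t -> xi_pair p t (xi1 t) (xi2 t)) /\
    exists tau : R,
      [/\ [/\ 1 < tau,
              xi_weight p tau (xi1 tau) = xi_weight p tau (xi2 tau) &
              forall t : R, 1 < t ->
                xi_weight p t (xi1 t) = xi_weight p t (xi2 t) -> t = tau],
          tau%:E = tau_sup p,
          T_sup p d @[d --> \oo] --> tau_sup p &
          ~ exists a : nat -> R,
              [/\ in_lpA p (fun k => (a k)%:C),
                  a 0%N != 0 &
                  forall k : nat, recurrence p tau a k]].
Proof.
have p0 : 0 < p by exact: lt_trans hp1.
(* For t <= 1 an arbitrary pair makes the choice total. *)
have : forall t, exists x : R * R, 1 < t -> xi_pair p t x.1 x.2.
  move=> t; have [t1|] := ltP 1 t; last by exists (0, 0).
  by have [x1 [x2 [xi _ _]]] := xi_pair_ex hp1 t1; exists (x1, x2).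
move=> /choice[xi xiP]; pose xi1 t := (xi t).1; pose xi2 t := (xi t).2.
exists xi1, xi2; split => //.
have [tau tau1 tauE] := tau_ex hp1 hp2 xiP; exists tau.
have incr := xi_weight1_incr hp1 xiP; have decr := xi_weight2_decr hp1 xiP.
(* The common value of q at xi_1 and xi_2: [below] reads it as the first weight over p, [above] as
   the second, through [tauE]. *)
pose c := xi_weight p tau (xi1 tau) / p.
have c0 : 0 < c by rewrite divr_gt0// (xi_weight1_gt0 hp1 tau1 (xiP _ tau1)).
have below (y : R) : 0 <= y -> y < 1 -> c * (1 - y `^ p) <= (tau - y) `^ (p - 1).
  move=> y0 y1; rewrite /c mulrAC ler_pdivrMr// [leRHS]mulrC.
  exact: (xi_weight1_le hp1 tau1 (xiP _ tau1)).
have above (y : R) : tau <= y -> (y - tau) `^ (p - 1) <= c * (y `^ p - 1).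
  move=> ty; rewrite /c mulrAC ler_pdivlMr// [leLHS]mulrC tauE.
  exact: (xi_weight2_ge hp1 tau1 (xiP _ tau1)).
have kub := fun x y : R[i] => kernel_le x y hp1 tau1 (ltW c0) below above.
have tau0 : 0 <= tau by rewrite ltW// (lt_trans _ tau1).
have uniq t : 1 < t -> xi_weight p t (xi1 t) = xi_weight p t (xi2 t) -> t = tau.
  move=> t1 tE; case: (ltgtP t tau) => // h.
    by have := lt_trans (decr _ _ t1 h) _; rewrite -tE -tauE => /(_ _ (incr _ _ t1 h));
      rewrite ltxx.
  by have := lt_trans (incr _ _ tau1 h) _; rewrite tE tauE => /(_ _ (decr _ _ tau1 h));
    rewrite ltxx.
split => //; last first.
- move=> [a [alp a0 arec]]; move/eqP: a0; apply.
  apply: (recurrence_lp_eq0 hp1 tau1 c0 _ alp arec) => x y.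
  exact: real_kernel_le hp1 tau1 (ltW c0) below above x y.
- exact: T_sup_cvg.
apply/eqP; rewrite eq_le; apply/andP; split; last first.
  by apply: ge_ereal_sup => _ [d _ <-]; exact: T_sup_le kub.
suff lower t : 1 < t -> t < tau -> (t%:E <= tau_sup p)%E.
  (* The maximum with (1 + tau)/2 keeps t above 1. *)
  apply/lee_subgt0Pr => e e0; pose t := Num.max (tau - e) ((1 + tau) / 2).
  rewrite -EFinB; apply: (@le_trans _ _ t%:E).
    by rewrite lee_fin le_max lexx.
  apply: lower; first by rewrite lt_max; apply/orP; right; lra.
  by rewrite gt_max; apply/andP; split; lra.
move=> t1 ttau; have xit := xiP _ t1.
have [x10 x12 xiE] := xit; have [x11 tx2] := xi_pair_bounds hp1 t1 xit.
have x20 := lt_trans x10 x12; have x21 := lt_trans t1 tx2.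
have w12 : xi_weight p t (xi1 t) < xi_weight p t (xi2 t).
  by rewrite (lt_trans (incr _ _ t1 ttau))// tauE decr.
have a0 := xi_weight1_gt0 hp1 t1 xit.
have w1 := xi_weight_powR hp1 x10 ((xiE _ x10).2 (or_introl erefl)).
have w2 := xi_weight_powR hp1 x20 ((xiE _ x20).2 (or_intror erefl)).
have x1p : (xi1 t) `^ p < 1 by rewrite powR_lt1// ltW.
have x2p : 1 < (xi2 t) `^ p by rewrite powR_gt1.
move: w1 w2 w12 a0 => w1 w2 w12 a0.
set A := xi_weight p t (xi1 t) in w1 w12 a0.
set B := xi_weight p t (xi2 t) in w2 w12.
(* Midway between q(xi_1) = A/p and q(xi_2) = B/p. Since xi_1^p - 1 < 0 < xi_2^p - 1, both ratios
   beat the slope m, by g1 and g2. *)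
pose m := (A + B) / 2 / p.
pose g1 := (B - A) / 2 / p * (1 - xi1 t `^ p).
pose g2 := (B - A) / 2 / p * (xi2 t `^ p - 1).
have g10 : 0 < g1 by rewrite mulr_gt0 ?divr_gt0 ?subr_gt0.
have g20 : 0 < g2 by rewrite mulr_gt0 ?divr_gt0 ?subr_gt0.
have d0 : 0 < Num.min g1 g2 by rewrite lt_min g10.
have m0 : 0 <= m by rewrite !divr_ge0 ?addr_ge0 ?ltW// (lt_trans a0).
have gain1 : m * (xi1 t `^ p - 1) + Num.min g1 g2 <= (xi1 t - t) * `|xi1 t - t| `^ (p - 2).
  apply: (@le_trans _ _ (m * (xi1 t `^ p - 1) + g1)); first by rewrite lerD2l ge_min lexx.
  rewrite -(ler_pM2l p0) -w1 /m /g1 le_eqVlt; apply/orP; left; apply/eqP.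
  by field; rewrite gt_eqF.
have gain2 : m * (xi2 t `^ p - 1) + Num.min g1 g2 <= (xi2 t - t) * `|xi2 t - t| `^ (p - 2).
  apply: (@le_trans _ _ (m * (xi2 t `^ p - 1) + g2)); first by rewrite lerD2l ge_min lexx orbT.
  rewrite -(ler_pM2l p0) -w2 /m /g2 le_eqVlt; apply/orP; left; apply/eqP.
  by field; rewrite gt_eqF.
have [b [n [b0 bn Kt]]] := zigzag_ex hp1 t1 m0 d0 x10 x11 x21 gain1 gain2.
(* As b_{n+1} = 0, telescoping at tau bounds the sum by -c |b_0|^p. *)
have Ktau : kernel_sum p tau 1 (fun k => (b k)%:C) n.+1 <= 0.
  have := kernel_sum_le kub (fun k => (b k)%:C) n.+1 (_ : modulus 1 = 1).
  rewrite (modulus_real 1) normr1 => /(_ erefl) /le_trans; apply.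
  rewrite !modulus_real (bn n.+1)// normr0 powR0 ?gt_eqF// sub0r.
  by rewrite mulr_ge0_le0 ?(ltW c0)// oppr_le0 powR_ge0.
apply: le_trans (T_sup_ge hp1 (ltW ttau) b0 bn Kt Ktau) _.
(* Degree n + 1 instead of n, because [tau_sup] admits only degrees at least 1. *)
apply: le_ereal_sup_tmp; exists (T_sup p n.+1); first by exists n.+1.
exact: T_sup_nondecreasing.
Qed.
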